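(* Let $n\ge1$, let $\lambda=(n,n-1,\dots,2,1)$ and let $w\in S_n$. Then $\mathcal{D}_\lambda(w)$ is a convex polytope (in $\mathbb{Z}^{N}$, $N=|\lambda|=\lambda_1+\cdots+\lambda_n$) if and only if $w$ is 312-avoiding.
   Context: The Young diagram of $\lambda$ has $\lambda_i$ left-justified boxes in row $i$, and $(j,i)$ denotes the box in column $j$ and row $i$. $\zeta=(\zeta_1,\dots,\zeta_{\lambda_1})$ is the sequence of column lengths. $\mathcal{T}_\lambda$ is the set of semistandard tableaux of shape $\lambda$: fillings with entries in $\{1,\dots,n\}$, weakly increasing along rows and strictly increasing down columns. $T\le T'$ means $T(j,i)\le T'(j,i)$ for all boxes $(j,i)$. The one rowed form of $w\in S_n$ is $(x_1,\dots,x_n)$ with $x_i=w(i)$. $w$ is 312-avoiding if there do not exist $1\le a<b<c\le n$ with $x_b<x_c<x_a$. The key of $w$, $Y_\lambda(w)$, is the tableau of shape $\lambda$ each of whose columns of length $k$ consists of $x_1,\dots,x_k$ arranged in increasing order downward. A skew tableau is a filling of a skew diagram with entries in $\{1,\dots,n\}$, weakly increasing along rows and strictly increasing down columns. Its rectification is the (well-defined) semistandard tableau obtained by successive jeu de taquin slides into inside corners until none are left. It is frank if its column lengths are a rearrangement of those of its rectification. For $T\in\mathcal{T}_\lambda$, the right key $R(T)$ is the tableau of shape $\lambda$ whose $j$th column is the rightmost column of any frank skew tableau that rectifies to $T$ and whose rightmost column has length $\zeta_j$ (this is well defined). The set of Demazure tableaux is $\mathcal{D}_\lambda(w):=\{T\in\mathcal{T}_\lambda\mid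 R(T)\le Y_\lambda(w)\}$. Each tableau of shape $\lambda$ is regarded as a point of $\mathbb{Z}^N$ by reading its entries in some fixed order. A subset $\mathcal{S}\subseteq\mathbb{Z}^N$ is called a convex polytope if for some $m\ge1$ there exist a real $m\times N$ matrix $A$ and an $m\times1$ real column vector $b$ such that $\mathcal{S}$ is the set of integral solutions $x\in\mathbb{Z}^N$ of $Ax\le b$. *)

(* Defs.v *)
From mathcomp Require Import all_boot all_order all_algebra all_fingroup.
From mathcomp Require Import boolp classical_sets reals.
From Stdlib Require Import Relation_Operators.

Set Implicit Arguments.
Unset Strict Implicit.
Unset Printing Implicit Defensive.

(* Conventions.  Rows and columns are numbered from 0, so that the box in
   column j and row i of the literature is the pair (i.-1, j.-1) here; entries
   keep their values 1, ..., n.  A partition is a weakly decreasing list of row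
   lengths read with default 0, so that trailing zeros are irrelevant. *)

Definition in_diagram (lam : seq nat) (i j : nat) : bool := j < nth 0 lam i.

Definition col_length (lam : seq nat) (j : nat) : nat :=
  count (fun r => j < r) lam.

(* A filling of outer / inner; the values of [entry] outside of the skew
   diagram are irrelevant.  The pair (inner, outer) is part of the data, since
   the inside corners depend on it. *)
Record skew := Skew {
  inner : seq nat;
  outer : seq nat;
  entry : nat -> nat -> nat
}.

Definition in_skew (S : skew) (i j : nat) : bool :=
  in_diagram (outer S) i j && ~~ in_diagram (inner S) i j.

Definition skew_tableau (n : nat) (S : skew) : Prop :=
  [/\ sorted geq (inner S) /\ sorted geq (outer S),
      forall i, nth 0 (inner S) i <= nth 0 (outer S) i,
      forall i j, in_skew S i j -> 1 <= entry S i j <= n,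
      forall i j, in_skew S i j -> in_skew S i j.+1 ->
        entry S i j <= entry S i j.+1
    & forall i j, in_skew S i j -> in_skew S i.+1 j ->
        entry S i j < entry S i.+1 j].

Definition column (S : skew) (j : nat) : seq nat :=
  [seq entry S i j | i <- iota 0 (size (outer S)) & in_skew S i j].

(* Only the nonempty columns, from left to right: [outer / inner] may have
   columns without boxes. *)
Definition columns (S : skew) : seq (seq nat) :=
  [seq c <- [seq column S j | j <- iota 0 (head 0 (outer S))] | c != [::]].

Definition rightmost_column (S : skew) : seq nat := last [::] (columns S).

(* Tableaux of straight shape are given by their list of rows. *)
Definition tab_entry (T : seq (seq nat)) (i j : nat) : nat :=
  nth 0 (nth [::] T i) j.

Definition straight (T : seq (seq nat)) : skew :=
  Skew [::] (shape T) (tab_entry T).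

Definition semistandard (n : nat) (lam : seq nat) (T : seq (seq nat)) : Prop :=
  shape T = lam /\ skew_tableau n (straight T).

Definition tab_le (T T' : seq (seq nat)) : Prop :=
  forall i j, in_diagram (shape T) i j -> tab_entry T i j <= tab_entry T' i j.

(* [hole_slide nu i j f nu' f']: starting from the filling f with a hole at
   (i, j), the smaller of the right and lower neighbours of the hole (the lower
   one in case of equality) is moved into it, until the hole is an outside
   corner and is removed; this yields the outer shape nu' and the filling f'. *)
Inductive hole_slide (nu : seq nat) : nat -> nat -> (nat -> nat -> nat) ->
    seq nat -> (nat -> nat -> nat) -> Prop :=
| hole_stop i j f :
    ~~ in_diagram nu i j.+1 -> ~~ in_diagram nu i.+1 j ->
    hole_slide nu i j f (set_nth 0 nu i j) f
| hole_right i j f nu' f' :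
    in_diagram nu i j.+1 ->
    (in_diagram nu i.+1 j -> f i j.+1 < f i.+1 j) ->
    hole_slide nu i j.+1
      (fun a b => if (a == i) && (b == j) then f i j.+1 else f a b) nu' f' ->
    hole_slide nu i j f nu' f'
| hole_down i j f nu' f' :
    in_diagram nu i.+1 j ->
    (in_diagram nu i j.+1 -> f i.+1 j <= f i j.+1) ->
    hole_slide nu i.+1 j
      (fun a b => if (a == i) && (b == j) then f i.+1 j else f a b) nu' f' ->
    hole_slide nu i j f nu' f'.

Definition inside_corner (mu : seq nat) (i j : nat) : bool :=
  [&& in_diagram mu i j, ~~ in_diagram mu i j.+1 & ~~ in_diagram mu i.+1 j].

Definition slide (S S' : skew) : Prop :=
  exists i j : nat,
    [/\ inside_corner (inner S) i j,
        inner S' = set_nth 0 (inner S) i j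
      & hole_slide (outer S) i j (entry S) (outer S') (entry S')].

(* The rectification is unique, but this is a theorem, so it is introduced as a
   relation: T is reached from S by successive slides into inside corners. *)
Definition rectifies_to (S : skew) (T : seq (seq nat)) : Prop :=
  exists S' : skew,
    [/\ clos_refl_trans skew slide S S',
        forall i j, ~~ inside_corner (inner S') i j,
        forall i j, in_skew S' i j = in_diagram (shape T) i j
      & forall i j, in_skew S' i j -> entry S' i j = tab_entry T i j].

(* S is frank, T being its rectification. *)
Definition frank_with (S : skew) (T : seq (seq nat)) : Prop :=
  rectifies_to S T /\
  perm_eq (shape (columns S)) (shape (columns (straight T))).

(* R is the right key of T.  Its columns do not depend on the choice of the
   frank skew tableaux S. *)
Definition is_right_key (n : nat) (lam : seq nat) (T R : seq (seq nat)) : Prop :=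
  shape R = lam /\
  forall j, j < head 0 lam ->
    exists S : skew,
      [/\ skew_tableau n S, frank_with S T,
          size (rightmost_column S) = col_length lam j
        & column (straight R) j = rightmost_column S].

Definition one_row (n : nat) (w : 'S_n) : seq nat := [seq (w i).+1 | i : 'I_n].

Definition key (n : nat) (lam : seq nat) (w : 'S_n) : seq (seq nat) :=
  [seq [seq nth 0 (sort leq (take (col_length lam j) (one_row w))) i
       | j <- iota 0 (nth 0 lam i)]
  | i <- iota 0 (size lam)].

Definition avoids_312 (n : nat) (w : 'S_n) : Prop :=
  ~ exists a b c : 'I_n, [/\ a < b, b < c, w b < w c & w c < w a].

Definition demazure (n : nat) (lam : seq nat) (w : 'S_n) :
    set (seq (seq nat)) :=
  [set T | semistandard n lam T /\
           exists R, is_right_key n lam T R /\ tab_le R (key lam w)]%classic.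

(* Entries are read row by row. *)
Definition tab_point (lam : seq nat) (T : seq (seq nat)) :
    'cV[int]_(sumn lam) :=
  (\col_(k < sumn lam) (nth 0%N (flatten T) k)%:Z)%R.

Definition convex_polytope (R : realType) (N : nat) (S : set 'cV[int]_N) :
    Prop :=
  exists (m : nat) (A : 'M[R]_(m, N)) (b : 'cV[R]_m),
    1 <= m /\
    S = [set x | forall i, ((A *m map_mx intr x) i ord0 <= b i ord0)%R]%classic.

Definition staircase (n : nat) : seq nat := rev (iota 1 n).

(* Main.v *)
Require Import Defs.
From mathcomp Require Import all_boot all_order all_algebra all_fingroup.
From mathcomp Require Import boolp classical_sets reals.
From mathcomp Require Import zify.
From Stdlib Require Import Relation_Operators.

(** A tableau is encoded by the list of its columns, each of them read from
    bottom to top; the concatenation of this list is its reading word.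

    If [w] avoids 312, then its Demazure set consists of all semistandard
    tableaux below its key ([avoids_312_demazure]), a set which is given by
    linear inequalities between entries ([ideal_polytope]).  If [w] contains
    312, then there are three tableaux on a line such that the outer two belong
    to the Demazure set and the one between them does not ([tab_demazure],
    [tab_not_demazure], [tab_collinear]).  Both facts come from a description
    of the right key by inequalities ([right_key_upper], [right_key_lower]).

    This description starts from the invariance of the Knuth class of the
    reading word under jeu de taquin ([slide_knuth]).  A Knuth class contains
    at most one tableau of straight shape ([straight_unique]): the raising
    operators of the crystal of words respect Knuth equivalence, they preserve
    lists of columns as well as straight shapes, and they lead to highest
    weight tableaux, which are determined by their contents.  The raising
    operators also explain frankness.  They lead from a list of columns with
    the same lengths as those of its rectification to a list of columns of the
    form 1, ..., k, because these are the columns of least sum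
    ([frank_transfer]).  For such initial columns it is obvious that two
    adjacent ones can be exchanged within the Knuth class, and the lowering
    operators transport this to every frank list ([frank_swap]).  Hence a frank
    skew tableau is sorted into its rectification by exchanges of adjacent
    columns, and conversely the [j]th column of the right key of a tableau is
    obtained by moving the [j]th column to the right end.

    In an exchange of a column [A] with a shorter column [B] on its right, let
    [A'] be the column of the length of [A] which results.  The longest
    decreasing subsequence with letters at least [k] is invariant under Knuth
    equivalence, and it shows that the number of entries of [A'] which are at
    least [k] is the maximum, over all [s >= k], of the number of entries of
    [A] which are at least [s] plus the number of entries of [B] in [k, s)
    ([swap_upper], [swap_lower]). *)

Set Implicit Arguments.
Unset Strict Implicit.
Unset Printing Implicit Defensive.
(** * Knuth equivalence *)

Lemma gtn_trans : transitive gtn.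
Proof. by move=> y x z xy yz; apply: ltn_trans yz xy. Qed.

Inductive knuth_rule : seq nat -> seq nat -> Prop :=
| knuth_rule1 x y z : x <= y < z -> knuth_rule [:: x; z; y] [:: z; x; y]
| knuth_rule2 x y z : x < y <= z -> knuth_rule [:: y; x; z] [:: y; z; x].

Inductive knuth : seq nat -> seq nat -> Prop :=
| knuth_step l r u v : knuth_rule u v -> knuth (l ++ u ++ r) (l ++ v ++ r)
| knuth_refl u : knuth u u
| knuth_sym u v : knuth u v -> knuth v u
| knuth_trans v u w : knuth u v -> knuth v w -> knuth u w.

Lemma knuth_ctx l r u v : knuth u v -> knuth (l ++ u ++ r) (l ++ v ++ r).
Proof.
elim=> {u v} [l' r' u v uv|u|u v _|v u w _ IH1 _ IH2].
- have := knuth_step (l ++ l') (r' ++ r) uv.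
  by rewrite -!catA.
- exact: knuth_refl.
- exact: knuth_sym.
- exact: knuth_trans IH1 IH2.
Qed.

Lemma knuth_catl l u v : knuth u v -> knuth (l ++ u) (l ++ v).
Proof. by move/(knuth_ctx l [::]); rewrite !cats0. Qed.

Lemma knuth_catr r u v : knuth u v -> knuth (u ++ r) (v ++ r).
Proof. exact: (@knuth_ctx [::]). Qed.

Lemma knuth_perm u v : knuth u v -> perm_eq u v.
Proof.
elim=> {u v} [l r u v uv|u|u v _|v u w _ IH1 _ IH2] //.
- rewrite perm_cat2l perm_cat2r.
  case: uv => x y z _; apply/seq.permP => a /=; lia.
- by rewrite perm_sym.
- exact: perm_trans IH1 IH2.
Qed.

(** The first rule moves [a] past each letter but the last one, the following
    letter being the witness. *)
Lemma knuth_small_right a d a' :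
  sorted gtn (rcons d a') -> a <= a' -> knuth (a :: rcons d a') (d ++ [:: a; a']).
Proof.
elim: d => [|x d IH] /= sd aa; first exact: knuth_refl.
have [y [d' Ed]] : exists y d', rcons d a' = y :: d'.
  by case: (d) => [|y d'] /=; [exists a', [::] | exists y, (rcons d' a')].
have sd' : sorted gtn (rcons d a') by apply: path_sorted sd.
have ya : a <= y < x.
  move: sd sd'; rewrite Ed /= => /andP[/= yx _] /(order_path_min gtn_trans) /allP h.
  have: a' \in y :: d' by rewrite -Ed mem_rcons mem_head.
  by rewrite inE => /orP[/eqP|/h /=]; lia.
apply: knuth_trans _ (knuth_catl [:: x] (IH sd' aa)).
by rewrite Ed; apply: (@knuth_step [::] d' [:: a; x; y] [:: x; a; y]); constructor.
Qed.

(** The second rule moves [z] past each letter but the first one, the preceding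
    letter being the witness. *)
Lemma knuth_large_left b d z :
  sorted gtn (b :: d) -> b <= z -> knuth (b :: rcons d z) [:: b, z & d].
Proof.
elim/last_ind: d => [|d x IH] sd bz; first exact: knuth_refl.
have sd' : sorted gtn (b :: d).
  by move: sd; rewrite -rcons_cons -cats1 => /cat_sorted2[].
rewrite -!rcons_cons; apply: knuth_trans (_ : knuth (rcons (b :: rcons d z) x) _); last first.
  by have := knuth_catr [:: x] (IH sd' bz); rewrite !cats1.
have [l [y E]] : exists l y, b :: d = rcons l y.
  by exists (belast b d), (last b d); rewrite lastI.
have /andP[xy yb] : x < y <= b.
  move: sd sd'; rewrite -rcons_cons E => s1 s2; apply/andP; split.
    by move: s1; rewrite -!cats1 -catA => /cat_sorted2[_] /= /andP[].
  case: l E {s1} s2 => [|b' l] /= E; first by case: E => -> _.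
  case: E => <- _ /(order_path_min gtn_trans) /allP /(_ y).
  by rewrite mem_rcons mem_head => /(_ isT) /ltnW.
rewrite -[rcons (rcons _ _) _]/(rcons (rcons (b :: d) x) z).
rewrite -!rcons_cons E -!cats1 -!catA /=.
have := @knuth_step l [::] [:: y; x; z] [:: y; z; x]; rewrite !cats0; apply; constructor.
by rewrite xy (leq_trans yb bz).
Qed.

(** * Horizontal moves of a slide *)

(** Two adjacent columns are [b _ t] and [b' x t'], where the hole [_] and [x]
    are in the same row, and [x] moves into the hole.  Each letter [a] of [t]
    can be moved to the letter [a'] of [t'] on its right, and each letter [z] of
    [b'] to the letter [y] of [b] on its left; this leaves nothing for [x] to
    pass. *)
Lemma knuth_horizontal b t b' x t' :
  sorted gtn (b ++ x :: t) -> sorted gtn (b' ++ x :: t') ->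
  (forall i, i < size t -> nth 0 t i <= nth 0 t' i) -> size t <= size t' ->
  (forall i, i < size b' -> nth 0 (rev b) i <= nth 0 (rev b') i) ->
  size b' <= size b ->
  knuth (b ++ t ++ b' ++ x :: t') (b ++ x :: t ++ b' ++ t').
Proof.
elim/last_ind: t t' => [|t a IHt] t' sb sb' ltt szt lbb szb.
  rewrite /=; apply: (@knuth_trans (b ++ x :: b' ++ t')); last first.
    by rewrite -cat1s catA; exact: knuth_refl.
  rewrite -[x :: b' ++ t']/([:: x] ++ b' ++ t') -[x :: t']/([:: x] ++ t').
  rewrite !catA; apply: knuth_catr; rewrite -!catA.
  have {}sb : sorted gtn (rcons b x) by rewrite -cats1.
  have {}sb' : sorted gtn (rcons b' x).
    by move: sb'; rewrite -cat_rcons => /cat_sorted2[].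
  elim: b' b sb sb' lbb szb => [|z b' IHb] b sb sb' lbb szb.
    by rewrite !cats0; exact: knuth_refl.
  have [b0 [y [b1 [Eb sz1]]]] : exists b0 y b1, b = b0 ++ y :: b1 /\ size b1 = size b'.
    exists (take (size b - (size b').+1) b), (nth 0 b (size b - (size b').+1)),
           (drop (size b - (size b').+1).+1 b).
    rewrite -drop_nth ?cat_take_drop; last by move: szb => /=; lia.
    by split=> //; rewrite size_drop; move: szb => /=; lia.
  have yz : y <= z.
    have := lbb (size b') (ltnSn _); rewrite Eb rev_cat rev_cons /= rev_cons.
    by rewrite -cats1 -catA !nth_cat !nth_rcons !size_rev sz1 ltnn subnn eqxx.
  have sy : sorted gtn (y :: rcons b1 x).
    by move: sb; rewrite Eb rcons_cat => /cat_sorted2[].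
  have sy1 : sorted gtn (y :: b1).
    by move: sy; rewrite -rcons_cons -cats1 => /cat_sorted2[].
  apply: (@knuth_trans ((b0 ++ [:: y; z]) ++ b1 ++ b' ++ [:: x])).
    rewrite Eb -!catA; apply: knuth_catl.
    have := knuth_catr (b' ++ [:: x]) (knuth_large_left sy1 yz).
    by rewrite /= cat_rcons.
  apply: (@knuth_trans ((b0 ++ [:: y; z]) ++ b1 ++ [:: x] ++ b')).
    apply/knuth_catl/IHb.
    - exact: path_sorted sy.
    - exact: path_sorted sb'.
    - move=> i ib; have := lbb i (ltnW ib).
      rewrite Eb rev_cat rev_cons -cats1 -catA rev_cons.
      by rewrite !nth_cat !nth_rcons !size_rev sz1 ib.
    - by rewrite sz1.
  rewrite Eb -!catA; apply/knuth_catl/knuth_sym.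
  have := knuth_catr b' (knuth_large_left sy yz).
  by rewrite /= -!cats1 -!catA.
have [s' [a' [r' [Et' sz']]]] : exists s' a' r', t' = s' ++ a' :: r' /\ size s' = size t.
  exists (take (size t) t'), (nth 0 t' (size t)), (drop (size t).+1 t').
  rewrite size_rcons in szt.
  by rewrite -drop_nth ?cat_take_drop // size_takel // ltnW.
have aa : a <= a'.
  have := ltt (size t); rewrite size_rcons => /(_ (ltnSn _)).
  by rewrite Et' nth_rcons nth_cat sz' ltnn subnn eqxx.
have s1 : sorted gtn (rcons (b' ++ x :: s') a').
  by move: sb'; rewrite Et' -(cat_rcons a') -cat_cons catA rcons_cat => /cat_sorted2[].
have s2 : sorted gtn (rcons (b' ++ s') a').
  apply: (subseq_sorted gtn_trans _ s1); rewrite -!cats1 !cat_subseq //.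
  exact: subseq_cons.
have H1 := knuth_catr r' (knuth_small_right s1 aa).
have H2 := knuth_catr r' (knuth_small_right s2 aa).
apply: (@knuth_trans ((b ++ t ++ b' ++ x :: s') ++ a :: a' :: r')).
  have := knuth_catl (b ++ t) H1.
  by rewrite Et' -!cats1; do 4 rewrite -?catA /=.
apply: (@knuth_trans ((b ++ x :: t ++ b' ++ s') ++ a :: a' :: r')); last first.
  have := knuth_sym (knuth_catl (b ++ x :: t) H2).
  by rewrite Et' -!cats1; do 4 rewrite -?catA /=.
apply: knuth_catr; apply: IHt => //.
- by move: sb; rewrite -cats1 -cat_cons catA => /cat_sorted2[].
- by move: s1; rewrite -cats1 => /cat_sorted2[].
- move=> i it; have := ltt i; rewrite size_rcons => /(_ (ltnW it)).
  by rewrite Et' nth_rcons nth_cat sz' it.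
- by rewrite sz'.
Qed.

(** * Crystal operators on words *)

Section Crystal.
Variable i : nat.

(** A letter [i.+1] is matched, like an opening bracket, with a later letter
    [i]; [phi] counts the unmatched [i] and [eps] the unmatched [i.+1]. *)
Fixpoint phi (v : seq nat) : nat :=
  if v is x :: v' then
    if x == i then (phi v').+1 else if x == i.+1 then (phi v').-1 else phi v'
  else 0.

Fixpoint eps (v : seq nat) : nat :=
  if v is x :: v' then ((x == i.+1) && (phi v' == 0)) + eps v' else 0.

Fixpoint raise (v : seq nat) : option (seq nat) :=
  if v is x :: v' then
    if (x == i.+1) && (phi v' == 0) then Some (i :: v')
    else omap (cons x) (raise v')
  else None.

Fixpoint lower (v : seq nat) : option (seq nat) :=
  if v is x :: v' then
    if x == i then
      if phi v' == 0 then Some (i.+1 :: v') else omap (cons x) (lower v')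
    else if (x == i.+1) && (phi v' <= 1) then None
    else omap (cons x) (lower v')
  else None.

(** The unmatched letters form a word [i ... i i.+1 ... i.+1]; in a product, the
    unmatched [i.+1] of the left factor are matched with the unmatched [i] of
    the right one. *)
Lemma phi_cat u v : phi (u ++ v) = phi u + (phi v - eps u).
Proof.
elim: u => [|x u IH] /=; first by rewrite subn0.
rewrite IH; have [->|_] := eqVneq x i; first by lia.
by have [_|_] /= := eqVneq x i.+1; lia.
Qed.

Lemma eps_cat u v : eps (u ++ v) = eps v + (eps u - phi v).
Proof.
elim: u => [|x u IH] /=; first by rewrite sub0n addn0.
by rewrite IH phi_cat; lia.
Qed.

Lemma raise_cat u v : raise (u ++ v) =
  if phi v < eps u then omap (cat^~ v) (raise u) else omap (cat u) (raise v).
Proof.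
elim: u => [|x u IH] /=; first by case: (raise v).
rewrite IH phi_cat; have [_|_] /= := eqVneq x i.+1; last first.
  by case: ifP => _; [case: (raise u) | case: (raise v)].
have [pu|pu] := posnP (phi u); last first.
  rewrite (_ : (_ == 0) = false) /= ?add0n; last by lia.
  by case: ifP => _; [case: (raise u) | case: (raise v)].
rewrite pu add0n subn_eq0 add1n ltnS; case: (leqP (phi v) (eps u)) => h //.
by rewrite ltnNge (ltnW h) /=; case: (raise v).
Qed.

Lemma raise_eps v : (raise v == None) = (eps v == 0).
Proof.
by elim: v => //= x v IH; case: ifP => //= _; rewrite add0n -IH; case: (raise v).
Qed.

Lemma lower_phi v : (lower v == None) = (phi v == 0).
Proof.
elim: v => //= x v IH; case: ifP => [_|xi]; first by rewrite -IH; case: (lower v).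
case: ifP => [/andP[-> ?]|]; first by rewrite eqxx; lia.
case: (x == i.+1) => /= h; last by rewrite -IH; case: (lower v).
have -> : ((phi v).-1 == 0) = false by lia.
by move: IH h; case: (lower v) => //=; lia.
Qed.

Lemma lower_cat u v : lower (u ++ v) =
  if eps u < phi v then omap (cat u) (lower v) else omap (cat^~ v) (lower u).
Proof.
elim: u => [|x u IH] /=.
  rewrite lt0n; have := lower_phi v.
  by case: (lower v) => [w|] <-.
rewrite IH phi_cat.
have E w : omap (cons x) (omap (cat w) (lower v)) = omap (cat (x :: w)) (lower v).
  by case: (lower v).
have E' w : omap (cons x) (omap (cat^~ w) (lower u)) = omap (cat^~ w) (omap (cons x) (lower u)).
  by case: (lower u).
have [xi|xi] /= := eqVneq x i.
  have -> /= : (x == i.+1) = false by lia.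
  have [h|h] := ltnP (eps u) (phi v).
    by rewrite (_ : (_ == 0) = false) ?E //; lia.
  by rewrite (_ : _ - _ = 0) ?addn0; [case: ifP | lia].
have [xi'|xi'] /= := eqVneq x i.+1; last by rewrite add0n; case: ifP => _; rewrite ?E ?E'.
have [h|h] := ltnP (eps u) (phi v).
  have [pu|pu] := posnP (phi u); last first.
    have -> : (phi u + (phi v - eps u) <= 1) = false by lia.
    by rewrite add0n h -E.
  rewrite pu add0n add1n; have [h'|h'] := ltnP (eps u).+1 (phi v).
    have -> : (phi v - eps u <= 1) = false by lia.
    by rewrite -E.
  have -> : (phi v - eps u <= 1) = true by lia.
  by [].
rewrite (_ : phi v - eps u = 0) ?addn0; last by lia.
rewrite (_ : (_ < _) = false); last by lia.
by case: ifP.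
Qed.

Lemma phi_raise u v : raise u = Some v -> phi v = (phi u).+1 /\ (eps v).+1 = eps u.
Proof.
elim: u v => //= x u IH v; case: ifP => [/andP[/eqP -> /eqP pu] [<-]|h].
  by rewrite /= pu !eqxx (_ : (_ == _) = false); lia.
case: (raise u) IH => //= w /(_ w erefl)[pw ew] [<-] /=; rewrite pw.
by have [xi|xi] := eqVneq x i; have [xi'|xi'] := eqVneq x i.+1; move: h; lia.
Qed.

Lemma raise_lower u v : raise u = Some v -> lower v = Some u.
Proof.
elim: u v => //= x u IH v; case: ifP => [/andP[/eqP -> pu] [<-]|h].
  by rewrite /= eqxx pu.
case Eu: (raise u) IH => [w|] //= /(_ w erefl) lw [<-] /=; rewrite lw /=.
have [pw _] := phi_raise Eu.
have [xi|xi] := eqVneq x i; first by rewrite ifF //; lia.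
by rewrite ifF //; lia.
Qed.

Lemma phi_lower u v : lower u = Some v -> (phi v).+1 = phi u.
Proof.
elim: u v => //= x u IH v; have [xi|xi] := eqVneq x i.
  case: ifP => [/eqP pu [<-] /=|h]; first by rewrite pu eqxx (_ : (_ == _) = false); lia.
  by case: (lower u) IH => //= w /(_ w erefl) pw [<-] /=; rewrite xi eqxx -pw.
case: ifP => // h.
case: (lower u) IH => //= w /(_ w erefl) pw [<-] /=; rewrite (negPf xi) -pw.
by case: eqP h => // xi'; lia.
Qed.

Lemma lower_raise u v : lower u = Some v -> raise v = Some u.
Proof.
elim: u v => //= x u IH v; have [xi|xi] := eqVneq x i.
  case: ifP => [pu [<-] /=|h]; first by rewrite pu eqxx /= xi.
  case Eu: (lower u) IH => [w|] //= /(_ w erefl) pw [<-] /=.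
  by rewrite pw xi (_ : (_ == _) = false) //; lia.
case: ifP => // h.
case Eu: (lower u) IH => [w|] //= /(_ w erefl) pw [<-] /=.
by rewrite pw ifF //; have := phi_lower Eu; lia.
Qed.

Lemma count_raise s u v : raise u = Some v ->
  count (fun x => x < s) v = count (fun x => x < s) u + (s == i.+1).
Proof.
elim: u v => //= x u IH v; case: ifP => [/andP[/eqP -> pu] [<-] /=|h]; first by lia.
by case: (raise u) IH => //= w /(_ w erefl) E [<-] /=; rewrite E addnA.
Qed.

Ltac crystal_cases x y z i h :=
  have [xi|xi] := eqVneq x i; have [xi'|xi'] := eqVneq x i.+1; try (exfalso; lia);
  have [yi|yi] := eqVneq y i; have [yi'|yi'] := eqVneq y i.+1; try (exfalso; lia);
  have [zi|zi] := eqVneq z i; have [zi'|zi'] := eqVneq z i.+1; try (exfalso; lia);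
  simpl; (split=> // u'); try (by []);
  try (move=> [<-]; eexists; [reflexivity |
    first [left; constructor; lia | right; subst; constructor; lia]]).

(** Raising may turn an instance of the first rule into a reversed instance of
    the second one, as [y; x; z] = [i.+1; i; i.+1] shows. *)
Lemma knuth_rule_raise u v : knuth_rule u v ->
  [/\ phi u = phi v, eps u = eps v &
  forall u', raise u = Some u' ->
    exists2 v', raise v = Some v' & knuth_rule u' v' \/ knuth_rule v' u'].
Proof. by case=> x y z h /=; crystal_cases x y z i h. Qed.

Lemma knuth_rule_lower u v : knuth_rule u v ->
  [/\ phi u = phi v, eps u = eps v &
  forall u', lower u = Some u' ->
    exists2 v', lower v = Some v' & knuth_rule u' v' \/ knuth_rule v' u'].
Proof. by case=> x y z h /=; crystal_cases x y z i h. Qed.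

(** The crystal operators commute with Knuth equivalence.  For a rule inside of
    a longer word this follows from the product formulas, since the two sides of
    the rule have the same unmatched letters. *)
Lemma knuth_raise u v : knuth u v -> [/\ phi u = phi v, eps u = eps v &
  forall u', raise u = Some u' -> exists2 v', raise v = Some v' & knuth u' v'].
Proof.
elim=> {u v} [l r u v uv|u|u v _ [pE eE H]|v u w _ [pE eE H] _ [pE' eE' H']].
- have [pE eE H] := knuth_rule_raise uv.
  have {}H : raise u = None /\ raise v = None \/
      exists u' v', [/\ raise u = Some u', raise v = Some v' &
        knuth_rule u' v' \/ knuth_rule v' u'].
    have := raise_eps v; rewrite -eE -raise_eps; case: (raise u) H => [u'|_].
      by case/(_ u' erefl) => v' -> uv' _; right; exists u', v'.
    by case: (raise v) => //; left.
  rewrite !phi_cat !eps_cat !phi_cat pE eE !raise_cat !phi_cat pE eE; split=> // w.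
  case: ifP => _; first by case: (raise l) => //= w' [<-]; eexists; [reflexivity|apply: knuth_step].
  case: ifP => _; last by case: (raise r) => //= w' [<-]; eexists; [reflexivity|apply: knuth_step].
  case: H => [[-> ->]|[u' [v' [-> -> uv']]]] //= [<-].
  eexists; first reflexivity.
  by case: uv' => ?; [|apply: knuth_sym]; apply: knuth_step.
- by split=> // u' E; exists u' => //; constructor.
- split=> // v' Ev; have := raise_eps u; rewrite eE -raise_eps Ev.
  case Eu: (raise u) => [u'|] // _.
  by have [w] := H _ Eu; rewrite Ev => -[<-] ?; exists u' => //; apply: knuth_sym.
- split=> [||u' /H[v' /H'[w' Ew vw] uv]]; rewrite ?pE ?eE //.
  by exists w' => //; apply: knuth_trans uv vw.
Qed.

Lemma knuth_lower u v u' : knuth u v -> lower u = Some u' ->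
  exists2 v', lower v = Some v' & knuth u' v'.
Proof.
move=> uv; suff [_ _] : [/\ phi u = phi v, eps u = eps v &
  forall u', lower u = Some u' -> exists2 v', lower v = Some v' & knuth u' v'] by exact.
elim: uv => {u v u'} [l r u v uv|u|u v _ [pE eE H]|v u w _ [pE eE H] _ [pE' eE' H']].
- have [pE eE H] := knuth_rule_lower uv.
  have {}H : lower u = None /\ lower v = None \/
      exists u' v', [/\ lower u = Some u', lower v = Some v' &
        knuth_rule u' v' \/ knuth_rule v' u'].
    have := lower_phi v; rewrite -pE -lower_phi; case: (lower u) H => [u'|_].
      by case/(_ u' erefl) => v' -> uv' _; right; exists u', v'.
    by case: (lower v) => //; left.
  rewrite !phi_cat !eps_cat !phi_cat pE eE !lower_cat !phi_cat pE eE; split=> // w.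
  case: ifP => _; last by case: (lower l) => //= w' [<-]; eexists; [reflexivity|apply: knuth_step].
  case: ifP => _; first by case: (lower r) => //= w' [<-]; eexists; [reflexivity|apply: knuth_step].
  case: H => [[-> ->]|[u' [v' [-> -> uv']]]] //= [<-].
  eexists; first reflexivity.
  by case: uv' => ?; [|apply: knuth_sym]; apply: knuth_step.
- by split=> // u' E; exists u' => //; constructor.
- split=> // v' Ev; have := lower_phi u; rewrite pE -lower_phi Ev.
  case Eu: (lower u) => [u'|] // _.
  by have [w] := H _ Eu; rewrite Ev => -[<-] ?; exists u' => //; apply: knuth_sym.
- split=> [||u' /H[v' /H'[w' Ew vw] uv]]; rewrite ?pE ?eE //.
  by exists w' => //; apply: knuth_trans uv vw.
Qed.

End Crystal.

(** * Columns *)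

(** A column is read from bottom to top. *)
Definition is_col (c : seq nat) : bool := sorted gtn c && all (leq 1) c.

Definition count_lt (s : nat) (c : seq nat) : nat := count (fun x => x < s) c.

Fixpoint icol (k : nat) : seq nat := if k is k'.+1 then k :: icol k' else [::].

Lemma size_icol k : size (icol k) = k.
Proof. by elim: k => //= k ->. Qed.

Lemma mem_icol k x : (x \in icol k) = (0 < x <= k).
Proof. by elim: k => [|k IH] /=; rewrite ?in_nil ?inE ?IH; lia. Qed.

Lemma icol_is_col k : is_col (icol k).
Proof.
rewrite /is_col; apply/andP; split; first by elim: k => //= -[|k] //= ->; rewrite andbT.
by apply/allP => x; rewrite mem_icol => /andP[].
Qed.

Lemma is_col_cons x c : is_col (x :: c) -> is_col c /\ forall y, y \in c -> y < x.
Proof.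
rewrite /is_col /= => /and3P[p x1 ->]; rewrite (path_sorted p); split=> // y.
by move: p => /(order_path_min gtn_trans) /allP h /h.
Qed.

Lemma is_col_uniq c : is_col c -> uniq c.
Proof.
case/andP=> + _; apply: sorted_uniq => [|x]; first exact: gtn_trans.
by rewrite /= ltnn.
Qed.

Lemma is_col_gt0 c x : is_col c -> x \in c -> 0 < x.
Proof. by case/andP=> _ /allP; apply. Qed.

Lemma count_ltS c s : is_col c -> count_lt s.+1 c = count_lt s c + (s \in c).
Proof.
move=> /is_col_uniq /count_uniq_mem <-; rewrite /count_lt.
by elim: c => //= x c ->; lia.
Qed.

Lemma count_lt0 c : count_lt 0 c = 0.
Proof. by rewrite /count_lt; elim: c. Qed.

Lemma count_lt1 c : is_col c -> count_lt 1 c = 0.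
Proof.
move=> h; rewrite count_ltS // count_lt0; case: (boolP (0 \in c)) => // /(is_col_gt0 h).
by [].
Qed.

Lemma count_lt_bound c s : is_col c -> 0 < s -> count_lt s c < s.
Proof.
move=> h; case: s => // s _; elim: s => [|s IH]; first by rewrite count_lt1.
by rewrite count_ltS //; case: (_ \in _); lia.
Qed.

Lemma phi_eps_col i c : is_col c ->
  phi i c = (i \in c) && (i.+1 \notin c) /\ eps i c = (i.+1 \in c) && (i \notin c).
Proof.
elim: c => // x c IH /is_col_cons[/IH[pE eE] lt] /=; rewrite pE eE !inE.
move: (lt i) (lt i.+1).
case: (i \in c); case: (i.+1 \in c) => h1 h2;
  have [?|?] := eqVneq x i; have [?|?] := eqVneq x i.+1 => /=;
  split; try lia; exfalso; move: (h1) (h2); lia.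
Qed.

Lemma raise_path i x c c' :
  path gtn x c -> raise i c = Some c' -> path gtn x c'.
Proof.
elim: c x c' => //= y c IH x c' /andP[yx p]; case: ifP => [/andP[/eqP yi /eqP pc] [<-] /=|h].
  apply/andP; split; first by rewrite /gtn /= in yx *; lia.
  case: c p pc {IH} => //= z c /andP[zy ->] pz; rewrite andbT.
  by move: pz zy; case: eqP => //=; lia.
by case: (raise i c) (IH y) => //= d /(_ _ p erefl) pd [<-] /=; rewrite yx.
Qed.

Lemma lower_path i x c c' : x != i.+1 ->
  is_col (x :: c) -> lower i c = Some c' -> path gtn x c'.
Proof.
elim: c x c' => //= y c IH x c' xi h; have [hc ltx] := is_col_cons h.
have yx : y < x by apply: ltx; rewrite mem_head.
have p : path gtn y c by move/andP: hc => [].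
have [yi|yi] := eqVneq y i.
  case: ifP => [_ [<-] /=|_].
    apply/andP; split; first by move: xi yx; rewrite /gtn /=; lia.
    by case: c p {IH h hc ltx} => //= z c /andP[zy ->]; rewrite andbT; lia.
  case: (lower i c) (IH y) => //= d pd [<-] /=; rewrite yx pd //.
  by rewrite yi; lia.
have [yi'|yi'] := eqVneq y i.+1.
  have [hc' _] := is_col_cons hc.
  by rewrite /= (phi_eps_col i hc').1; case: (_ && _).
by case: (lower i c) (IH y) => //= d pd [<-] /=; rewrite yx pd.
Qed.

Lemma size_raise i c c' : raise i c = Some c' -> size c' = size c.
Proof.
elim: c c' => //= x c IH c'; case: ifP => [_ [<-] //|_].
by case: (raise i c) IH => //= d /(_ _ erefl) <- [<-].
Qed.

Lemma all_raise i c c' : 0 < i -> raise i c = Some c' -> all (leq 1) c -> all (leq 1) c'.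
Proof.
move=> i0; elim: c c' => //= x c IH c'; case: ifP => [_ [<-] /= /andP[_ ->]|_]; first by rewrite i0.
by case: (raise i c) IH => //= d /(_ _ erefl) h [<-] /= /andP[-> /h].
Qed.

Lemma all_lower i c c' : lower i c = Some c' -> all (leq 1) c -> all (leq 1) c'.
Proof.
elim: c c' => //= x c IH c'; case: ifP => _; [case: ifP => _ | case: ifP => _ //].
- by move=> [<-] /= /andP[_ ->].
- by case: (lower i c) IH => //= d /(_ _ erefl) h [<-] /= /andP[-> /h].
- by case: (lower i c) IH => //= d /(_ _ erefl) h [<-] /= /andP[-> /h].
Qed.

Lemma path_head c : sorted gtn c -> path gtn (head 0 c).+1 c.
Proof. by case: c => //= x c ->; rewrite ltnSn. Qed.

Lemma raise_col i c c' : 0 < i -> is_col c -> raise i c = Some c' -> is_col c'.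
Proof.
move=> i0 /andP[/path_head sc pc] E; rewrite /is_col (all_raise i0 E pc) andbT.
exact: path_sorted (raise_path sc E).
Qed.

Lemma lower_col i c c' : is_col c -> lower i c = Some c' -> is_col c'.
Proof.
move=> hc E; have /andP[sc pc] := hc; rewrite /is_col (all_lower E pc) andbT.
have [x [xi hx]] : exists x, x != i.+1 /\ is_col (x :: c).
  exists ((head 0 c) + i).+2; split; first by lia.
  rewrite /is_col /= pc andbT; case: (c) sc => //= y d ->; rewrite andbT; lia.
exact: path_sorted (lower_path xi hx E).
Qed.

Lemma sumn_raise i u v : raise i u = Some v -> sumn u = (sumn v).+1.
Proof.
elim: u v => //= x u IH v; case: ifP => [/andP[/eqP -> _] [<-] //|_].
by case: (raise i u) IH => //= d /(_ _ erefl) -> [<-] /=; lia.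
Qed.

(** In a column each letter exceeds the number of the letters above it. *)
Lemma icol_min c : is_col c ->
  sumn (icol (size c)) <= sumn c ?= iff (c == icol (size c)).
Proof.
elim: c => [|x c IH] hc; first by split.
have [hc' lt] := is_col_cons hc; have /leqifP := IH hc'.
have sx : size c < x.
  have := count_lt_bound hc' (is_col_gt0 hc (mem_head x c)).
  suff /eqP <- : count_lt x c == size c by [].
  by rewrite -all_count; apply/allP.
move=> H; apply/leqifP; rewrite /= eqseq_cons.
case: (c =P icol _) H => [<-|_]; case: (eqVneq x (size c).+1) => [->|?] /=;
  by rewrite ?andbT ?andbF //; try move/eqP; lia.
Qed.

(** * Straight lists of columns *)

(** For columns this means that [c] is at least as long as [d] and that its
    entries, from the top, are at most those of [d], so that [d] can be put on
    the right of [c] in a tableau. *)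
Definition dominates (c d : seq nat) : Prop := forall s, count_lt s d <= count_lt s c.

Fixpoint straight_cols (cs : seq (seq nat)) : Prop :=
  if cs is c :: cs' then dominates c (head [::] cs') /\ straight_cols cs' else True.

Lemma dominates_nil c : dominates c [::].
Proof. by move=> s. Qed.

Lemma dominates_refl c : dominates c c.
Proof. by move=> s. Qed.

Lemma dominates_trans c d b : dominates c d -> dominates d b -> dominates c b.
Proof. by move=> cd db s; apply: leq_trans (db s) (cd s). Qed.

Lemma straight_subst l c c' r :
  (forall l' b, l = rcons l' b -> dominates b c -> dominates b c') ->
  (dominates c (head [::] r) -> dominates c' (head [::] r)) ->
  straight_cols (l ++ c :: r) -> straight_cols (l ++ c' :: r).
Proof.
elim: l => [_ H /= [cr sr]|b l IH H1 H2 /= [bl sl]]; first by split=> //; apply: H.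
split; last by apply: IH => // l' b' E; apply: (H1 (b :: l') b'); rewrite E.
by case: (l) H1 bl => //= H1 ?; apply: (H1 [::] b).
Qed.

Lemma straight_catr l r : straight_cols (l ++ r) -> straight_cols r.
Proof. by elim: l => //= c l IH [_ /IH]. Qed.

Lemma straight_dominates c r d : straight_cols (c :: r) -> d \in r -> dominates c d.
Proof.
elim: r c => //= b r IH c [cb sr]; rewrite inE => /orP[/eqP -> //|dr].
exact: dominates_trans cb (IH _ sr dr).
Qed.

(** * The action of the crystal operators on lists of columns *)

Lemma raise_flatten i cs u : 0 < i -> all is_col cs -> raise i (flatten cs) = Some u ->
  exists l c c' r, [/\ cs = l ++ c :: r, u = flatten (l ++ c' :: r), raise i c = Some c',
    phi i (flatten r) = 0 & eps i (flatten l) <= phi i (flatten (c :: r))].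
Proof.
move=> i0; elim: cs u => //= c cs IH u /andP[hc hcs]; rewrite raise_cat.
have [pc ec] := phi_eps_col i hc.
case: ifP => h.
  case E: (raise i c) => [c'|] //= [<-]; exists [::], c, c', cs; split=> //.
  by move: h; rewrite ec; case: (_ && _); lia.
case E: (raise i _) => [v|] //= [<-].
have [l [d [d' [r [Ecs -> Ed p0 el]]]]] := IH _ hcs E.
exists (c :: l), d, d', r; split=> //=; first by rewrite Ecs.
move: h el; rewrite Ecs flatten_cat /= (phi_cat i (flatten l)) eps_cat; lia.
Qed.

Lemma raise_cols i cs u : 0 < i -> all is_col cs -> raise i (flatten cs) = Some u ->
  exists cs', [/\ all is_col cs', shape cs' = shape cs & u = flatten cs'].
Proof.
move=> i0 hcs /(raise_flatten i0 hcs)[l [c [c' [r [Ecs -> Ec _ _]]]]].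
exists (l ++ c' :: r); move: hcs; rewrite Ecs !all_cat /= => /and3P[-> hc ->].
by rewrite (raise_col i0 hc Ec) /shape !map_cat /= (size_raise Ec).
Qed.

Lemma lower_cols i cs u : all is_col cs -> lower i (flatten cs) = Some u ->
  exists cs', [/\ all is_col cs', shape cs' = shape cs & u = flatten cs'].
Proof.
elim: cs u => //= c cs IH u /andP[hc hcs]; rewrite lower_cat; case: ifP => _.
  case E: (lower i _) => [v|] //= [<-].
  have [cs' [h1 h2 ->]] := IH _ hcs E.
  by exists (c :: cs'); rewrite /= hc h1 h2.
case E: (lower i _) => [c'|] //= [<-]; exists (c' :: cs) => /=.
by rewrite (lower_col hc E) hcs -(size_raise (lower_raise E)).
Qed.

(** If the letter [i.+1] of [c] is the leftmost unmatched one, then the column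
    [b] on the left of [c] does not obstruct its change to [i]: otherwise [b]
    would contain an unmatched [i.+1] itself.  Symmetrically, if the list is
    straight after the change, then the next column on the right did not
    obstruct it before, as it would contain an unmatched [i] otherwise. *)
Lemma raise_straight i cs u : 0 < i -> all is_col cs -> raise i (flatten cs) = Some u ->
  exists cs', [/\ all is_col cs', shape cs' = shape cs, u = flatten cs' &
                  straight_cols cs <-> straight_cols cs'].
Proof.
move=> i0 hcs /(raise_flatten i0 hcs)[l [c [c' [r [Ecs -> Ec pr el]]]]].
move: hcs; rewrite Ecs all_cat /= => /and3P[hl hc hr].
have hc' := raise_col i0 hc Ec.
exists (l ++ c' :: r); split=> //.
- by rewrite all_cat /= hl hc' hr.
- by rewrite /shape !map_cat /= (size_raise Ec).
have cnt s := count_raise s Ec : count_lt s c' = count_lt s c + _.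
have [[pc ec] [pc' ec']] := (phi_eps_col i hc, phi_eps_col i hc').
have [E1 E2] := phi_raise Ec.
split; apply: straight_subst.
- move=> l' b El bc s; rewrite cnt; case: eqP => [->|_]; last by rewrite addn0.
  have hb : is_col b by move: hl; rewrite El all_rcons => /andP[].
  have c0 : phi i c = 0 by rewrite pc; move: E2; rewrite ec; case: (_ \in c); lia.
  have eb : eps i b = 0.
    move: el; rewrite El -cats1 flatten_cat eps_cat /= cats0 phi_cat; lia.
  have := bc i; have := bc i.+1; have := bc i.+2.
  have [_] := phi_eps_col i hb; rewrite eb.
  move: E2; rewrite ec ec' !count_ltS //.
  by case: (_ \in c); case: (_ \in c); case: (_ \in b); case: (_ \in b); lia.
- by move=> cd s; apply: leq_trans (cd s) _; rewrite cnt leq_addr.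
- by move=> l' b _ bc s; apply: leq_trans _ (bc s); rewrite cnt leq_addr.
- case: r pr hr {Ecs el} => [|d r] /= pr; first by move=> *; apply: dominates_nil.
  move=> /andP[hd _] cd s; have := cd s; rewrite cnt; case: eqP => [->|_]; last by rewrite addn0.
  have pd : phi i d = 0 by move: pr; rewrite phi_cat; lia.
  have := cd i; have := cd i.+2; have := cd i.+1; rewrite !cnt => H1 H2 H3 _.
  move: H1 H2 H3.
  have [+ _] := phi_eps_col i hd; rewrite pd.
  move: E1; rewrite pc pc'.
  have := cnt i; have := cnt i.+1; have := cnt i.+2; rewrite !count_ltS //.
  case: (_ \in c); case: (_ \in c); case: (_ \in c'); case: (_ \in c');
    by case: (_ \in d); case: (_ \in d) => /=; lia.
Qed.

(** * Frank lists of columns *)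

Inductive raises : seq nat -> seq nat -> Prop :=
| raises_refl v : raises v v
| raises_step i v u h : 0 < i -> raise i v = Some u -> raises u h -> raises v h.

Definition highest (v : seq nat) : Prop := forall i, 0 < i -> eps i v = 0.

Definition icols (sh : seq nat) : seq (seq nat) := map icol sh.

Lemma shape_icols sh : shape (icols sh) = sh.
Proof. by elim: sh => //= k sh {2}<-; rewrite size_icol. Qed.

(** A list of columns is frank when its crystal component has highest weight
    given by the lengths of the columns, which makes every column of the
    highest weight list initial. *)
Definition frank (cs : seq (seq nat)) : Prop :=
  raises (flatten cs) (flatten (icols (shape cs))).

Lemma raises_highest v : exists2 h, raises v h & highest h.
Proof.
elim: {v}(sumn v) {-2}v (leqnn (sumn v)) => [|m IH] v le.
  exists v; first exact: raises_refl.
  move=> i _; apply/eqP; rewrite -raise_eps.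
  by case E: (raise i v) => [u|] //; have := sumn_raise E; lia.
case: (pselect (highest v)) => [hv|nh]; first by exists v => //; exact: raises_refl.
have [i [i0 /eqP]] : exists i, 0 < i /\ eps i v <> 0.
  by apply: contrapT => H; apply: nh => i i0; apply: contrapT => e; apply: H; exists i.
rewrite -raise_eps; case E: (raise i v) => [u|] // _.
have [|h uh hh] := IH u; first by have := sumn_raise E; lia.
by exists h => //; apply: raises_step E uh.
Qed.

Lemma raises_knuth u v h : knuth u v -> raises u h -> exists2 h', raises v h' & knuth h h'.
Proof.
move=> + r; elim: r v => {u h} [u v uv|i u u' h i0 E _ IH v uv].
  by exists v => //; exact: raises_refl.
have [_ _ /(_ _ E)[v' Ev uv']] := knuth_raise i uv.
by have [h' vh hh] := IH _ uv'; exists h' => //; apply: raises_step Ev vh.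
Qed.

Lemma raises_straight cs h : all is_col cs -> raises (flatten cs) h ->
  exists cs', [/\ all is_col cs', shape cs' = shape cs, h = flatten cs' &
                  straight_cols cs <-> straight_cols cs'].
Proof.
move: {-1}(flatten cs) (erefl (flatten cs)) => u + + r.
elim: r cs => {u h} [u|i u v h i0 E _ IH] cs Eu hcs.
  by exists cs.
move: E; rewrite -Eu => /(raise_straight i0 hcs)[cs1 [h1 s1 E1 i1]].
have [cs2 [h2 s2 E2 i2]] := IH cs1 (esym E1) h1; exists cs2.
by split=> //; [rewrite s2 | apply: iff_trans i1 i2].
Qed.

Lemma flatten_shape_inj (T : eqType) (cs ds : seq (seq T)) :
  shape cs = shape ds -> flatten cs = flatten ds -> cs = ds.
Proof. by move=> Es Ef; rewrite -[cs]flattenK -[ds]flattenK Es Ef. Qed.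

Lemma phi_icols i sh : 0 < i -> phi i (flatten (icols sh)) = count_mem i sh /\
  eps i (flatten (icols sh)) = 0.
Proof.
move=> i0; rewrite /icols; elim: sh => //= k sh [IH1 IH2].
have [] := phi_eps_col i (icol_is_col k); rewrite !mem_icol i0 /= => E1 E2.
by rewrite phi_cat eps_cat IH1 IH2 E1 E2; split; lia.
Qed.

(** The smallest missing letter cannot be below another letter. *)
Lemma icolP c : is_col c -> (forall i, 0 < i -> i.+1 \in c -> i \in c) -> c = icol (size c).
Proof.
elim: c => //= x c IH hc H; have [hc' lt] := is_col_cons hc.
have {IH} Ec : c = icol (size c).
  apply: IH => // i i0 ic; have := H i i0; rewrite !inE ic orbT => /(_ isT) /orP[/eqP xi|//].
  by have := lt _ ic; lia.
have x0 := is_col_gt0 hc (mem_head x c).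
suff -> : x = (size c).+1 by rewrite -Ec.
have mc y : (y \in c) = (0 < y <= size c) by rewrite {1}Ec mem_icol.
have : size c < x.
  case: (posnP (size c)) => [-> //|s0]; apply: lt; rewrite mc; lia.
case: x x0 hc H lt => // -[|x] _ hc H lt; first by case: (size c).
have := H x.+1 isT (mem_head _ _); rewrite inE mc; lia.
Qed.

(** In a straight highest weight list, an unmatched letter [i.+1] of the column
    [c] would have to be matched with a later initial column of length [i],
    whose presence forces [i] to be a letter of [c]. *)
Lemma straight_highest cs : all is_col cs -> straight_cols cs -> highest (flatten cs) ->
  cs = icols (shape cs).
Proof.
elim: cs => // c cs IH /andP[hc hcs] st hw /=.
have hw' i : 0 < i -> eps i (flatten cs) = 0 /\ eps i c <= phi i (flatten cs).
  by move=> /hw /=; rewrite eps_cat; lia.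
have Ecs : cs = icols (shape cs) by apply: IH => //; [case: st | move=> i /hw'[]].
rewrite -/(icols _) -Ecs; congr cons; apply: icolP => // i i0 ic.
have [_ ec] := phi_eps_col i hc; apply: contraT => nic.
have [_] := hw' i i0; rewrite ec ic nic /= Ecs (phi_icols _ i0).1 lt0n.
rewrite -lt0n -has_count has_pred1 => /(map_f icol); rewrite -/(icols _) -Ecs.
move=> /(straight_dominates st) /(_ i.+1); rewrite [X in _ <= X]count_ltS // (negPf nic) addn0.
have := count_lt_bound hc i0.
suff -> : count_lt i.+1 (icol i) = i by lia.
rewrite /count_lt -[RHS](size_icol i); apply/eqP; rewrite -all_count; apply/allP => x.
by rewrite mem_icol => /andP[].
Qed.

(** Each column has at least the sum of the initial column of its length, with
    equality for initial columns only. *)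
Lemma icols_sumn cs : all is_col cs ->
  sumn (flatten cs) <= sumn (flatten (icols (shape cs))) -> cs = icols (shape cs).
Proof.
have H : all is_col cs -> sumn (flatten (icols (shape cs))) <= sumn (flatten cs).
  elim: cs => //= c cs IH /andP[/icol_min[h _] /IH]; rewrite !sumn_cat; lia.
elim: cs H => //= c cs IH _ /andP[hc hcs]; rewrite !sumn_cat.
have H : sumn (flatten (icols (shape cs))) <= sumn (flatten cs).
  elim: cs {IH} hcs => //= d cs IH /andP[/icol_min[h _] /IH]; rewrite !sumn_cat; lia.
have [h1 h2] := icol_min hc => le.
rewrite -IH //; last by lia.
by congr cons; apply/eqP; rewrite -h2; apply/eqP; lia.
Qed.

Lemma straight_frank cs : all is_col cs -> straight_cols cs -> frank cs.
Proof.
move=> hcs st; have [h rh hh] := raises_highest (flatten cs).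
have [ds [hds sds E i]] := raises_straight hcs rh.
have Eds : ds = icols (shape ds).
  by apply: straight_highest => //; [apply/i | rewrite -E].
by rewrite /frank -sds -Eds -E.
Qed.

(** Along Knuth equivalent words the same raising operators apply, and they end
    at words of the same sum.  This sum is the least possible one for the
    lengths of the columns, which forces the columns to be initial. *)
Lemma frank_transfer cs ds : all is_col cs -> all is_col ds -> frank cs ->
  knuth (flatten cs) (flatten ds) -> perm_eq (shape cs) (shape ds) -> frank ds.
Proof.
move=> hcs hds fr kn pe; have [h' rh kh] := raises_knuth kn fr.
have [es [hes ses E _]] := raises_straight hds rh.
rewrite /frank -ses -(icols_sumn hes) -?E //.
rewrite -(perm_sumn (knuth_perm kh)) ses.
rewrite (perm_sumn (_ : perm_eq _ (flatten (icols (shape ds))))) //.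
by apply: perm_flatten; apply: perm_map.
Qed.

(** Each raising operator acts on one of the two factors. *)
Lemma raises_cat u v h : raises (u ++ v) h ->
  exists u' v', [/\ h = u' ++ v', raises u u', raises v v' & size u' = size u].
Proof.
move: {-1}(u ++ v) (erefl (u ++ v)) => w + r; elim: r u v => {w h} [w|i w w' h i0 E _ IH] u v Ew.
  by exists u, v; split=> //; exact: raises_refl.
move: E; rewrite -Ew raise_cat; case: ifP => _.
  case Eu: (raise i u) => [u1|] //= [/IH[u' [v' [-> r1 r2 s]]]].
  by exists u', v'; split=> //; [apply: raises_step Eu r1 | rewrite s (size_raise Eu)].
case Ev: (raise i v) => [v1|] //= [/IH[u' [v' [-> r1 r2 s]]]].
by exists u', v'; split=> //; apply: raises_step Ev r2.
Qed.

Lemma frank_cat cs ds : frank (cs ++ ds) -> frank cs /\ frank ds.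
Proof.
rewrite /frank (_ : icols _ = icols (shape cs) ++ icols (shape ds)) ?flatten_cat; last first.
  by rewrite /icols -map_cat /shape -map_cat.
case/raises_cat=> [u [v [E r1 r2 s]]].
have /eqP := E; rewrite eqseq_cat; first by case/andP=> /eqP -> /eqP ->.
by rewrite s !size_flatten shape_icols.
Qed.

(** Initial columns of decreasing lengths form a straight list, and straightness
    is inherited backwards along raising operators. *)
Lemma frank_sorted_straight cs : all is_col cs -> frank cs -> sorted geq (shape cs) ->
  straight_cols cs.
Proof.
move=> hcs fr so; have [ds [hds sds E ->]] := raises_straight hcs fr.
have -> : ds = icols (shape ds).
  by apply: flatten_shape_inj; rewrite ?shape_icols // sds.
rewrite sds; elim: (shape cs) so => //= k sh IH so.
split; last by apply: IH; apply: path_sorted so.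
case: sh so {IH} => /= [_|m sh /andP[mk _]]; first exact: dominates_nil.
elim: k m mk => [|k IH] m; first by rewrite /geq /= leqn0 => /eqP ->; apply: dominates_refl.
rewrite /geq /= leq_eqVlt => /orP[/eqP ->|mk]; first exact: dominates_refl.
by move=> s; apply: leq_trans (IH m mk s) _; rewrite /count_lt /= leq_addl.
Qed.

(** The multiplicity of [i] in the initial columns is the number of columns of
    length at least [i]. *)
Lemma perm_icols_shape sh sh' : 0 \notin sh -> 0 \notin sh' ->
  perm_eq (flatten (icols sh)) (flatten (icols sh')) -> perm_eq sh sh'.
Proof.
move=> z z' pe; apply/allP => k _ /=; apply/eqP.
have H i : 0 < i -> count_mem i sh = count_mem i sh'.
  move=> i0.
  have E s : count_mem i (flatten (icols s)) = count_mem i s + count_mem i.+1 (flatten (icols s)).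
    rewrite /icols; elim: s => //= m s IH; rewrite !count_cat IH.
    have U j : count_mem j (icol m) = (j \in icol m).
      by apply/count_uniq_mem/is_col_uniq/icol_is_col.
    by rewrite !U !mem_icol; lia.
  by apply/(@addIn (count_mem i.+1 (flatten (icols sh)))); rewrite -E !(seq.permP pe) E.
case: k => [|k]; last exact: H.
by rewrite (count_memPn z) (count_memPn z').
Qed.

Lemma dominates_size c d : dominates c d -> size d <= size c.
Proof.
move=> /(_ (sumn d).+1) h; apply: leq_trans (count_size _ _); apply: leq_trans h.
rewrite leq_eqVlt eq_sym -all_count; apply/orP; left; apply/allP => x xd.
by rewrite ltnS sumnE (big_rem x xd) leq_addr.
Qed.

Lemma straight_sorted cs : straight_cols cs -> sorted geq (shape cs).
Proof.
elim: cs => //= c [|d cs] IH [cd st] //=; apply/andP; split; first exact: dominates_size cd.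
exact: IH.
Qed.

Lemma nil_shape (cs : seq (seq nat)) : (0 \in shape cs) = ([::] \in cs).
Proof. by elim: cs => //= c cs IH; rewrite !inE IH; case: c. Qed.

Lemma geq_trans : transitive geq.
Proof. by move=> y x z xy yz; apply: leq_trans yz xy. Qed.

Lemma geq_anti : antisymmetric geq.
Proof. by move=> x y /andP[xy yx]; apply/eqP; rewrite eqn_leq; apply/andP. Qed.

(** Raising is injective and respects Knuth equivalence, which reduces the claim
    to highest weight lists, and these are determined by their contents. *)
Lemma straight_unique cs ds : all is_col cs -> all is_col ds ->
  straight_cols cs -> straight_cols ds -> [::] \notin cs -> [::] \notin ds ->
  knuth (flatten cs) (flatten ds) -> cs = ds.
Proof.
elim: {cs}(sumn (flatten cs)).+1 {-2}cs (ltnSn (sumn (flatten cs))) ds => // m IH cs le ds.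
move=> hcs hds st st' ne ne' kn.
have eE i : eps i (flatten cs) = eps i (flatten ds) by have [] := knuth_raise i kn.
case: (pselect (highest (flatten cs))) => [hv|nh].
  have Ecs : cs = icols (shape cs) by apply: straight_highest.
  have Eds : ds = icols (shape ds) by apply: straight_highest => // i /hv; rewrite eE.
  rewrite Ecs Eds; congr icols.
  apply: (sorted_eq geq_trans geq_anti); rewrite ?straight_sorted //.
  by apply: perm_icols_shape; rewrite ?nil_shape -?Ecs -?Eds // knuth_perm.
have [i [i0 /eqP]] : exists i, 0 < i /\ eps i (flatten cs) <> 0.
  by apply: contrapT => H; apply: nh => i i0; apply: contrapT => e; apply: H; exists i.
rewrite -raise_eps; case E: (raise i _) => [u|] // _.
have [_ _ /(_ _ E)[v Ev uv]] := knuth_raise i kn.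
have := raise_straight i0 hcs E => -[cs1 [h1 s1 E1 i1]].
have := raise_straight i0 hds Ev => -[ds1 [h2 s2 E2 i2]].
have cd1 : cs1 = ds1.
  apply: IH => //; rewrite -?E1 -?E2 //; try by [apply/i1 | apply/i2].
  - by have := sumn_raise E; lia.
  - by rewrite -nil_shape s1 nil_shape.
  - by rewrite -nil_shape s2 nil_shape.
apply: flatten_shape_inj; first by rewrite -s1 -s2 cd1.
have := raise_lower E; have := raise_lower Ev; rewrite E1 E2 cd1 => -> [].
by [].
Qed.

(** * Exchanging two adjacent columns *)

Lemma nth_icol k i : nth 0 (icol k) i = k - i.
Proof. by elim: k i => [|k IH] [|i] //=; rewrite IH subSS. Qed.

Lemma subseq_icol m k : m <= k -> subseq (icol m) (icol k).
Proof.
elim: k => [|k IH]; first by rewrite leqn0 => /eqP ->.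
rewrite leq_eqVlt => /orP[/eqP -> //|/IH h].
exact: subseq_trans h (subseq_cons _ _).
Qed.

Lemma knuth_icol b m k : m <= k -> sorted gtn (b ++ icol k) ->
  knuth (b ++ icol m ++ icol k) (b ++ icol k ++ icol m).
Proof.
elim: k b => [|k IH] b; first by rewrite leqn0 => /eqP -> _; exact: knuth_refl.
rewrite leq_eqVlt => /orP[/eqP -> _|mk sb]; first exact: knuth_refl.
apply: (@knuth_trans ((b ++ [:: k.+1]) ++ icol m ++ icol k)).
  rewrite -[X in knuth _ X]catA.
  apply: (@knuth_horizontal b (icol m) [::] k.+1 (icol k)) => //.
  - apply: subseq_sorted sb; first exact: gtn_trans.
    by rewrite cat_subseq //= eqxx subseq_icol.
  - by have /andP[] := icol_is_col k.+1.
  - by move=> i _; rewrite !nth_icol; apply: leq_sub2r.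
  - by rewrite !size_icol.
have := IH (b ++ [:: k.+1]) mk; rewrite -[in X in X -> _]catA => /(_ sb).
by rewrite -!catA.
Qed.

Lemma knuth_icol_swap m k : knuth (icol m ++ icol k) (icol k ++ icol m).
Proof.
case: (leqP m k) => [|/ltnW] h; last apply: knuth_sym;
  by apply: (knuth_icol (b := [::])) => //; case/andP: (icol_is_col k); case/andP: (icol_is_col m).
Qed.

(** Two columns which form a frank list can be exchanged: this is clear for
    initial columns, and the lowering operators transport it. *)
Lemma frank_swap c d : is_col c -> is_col d -> frank [:: c; d] ->
  exists d' c', [/\ is_col d' /\ is_col c', size d' = size d, size c' = size c &
                    knuth (c ++ d) (d' ++ c')].
Proof.
move=> hc hd; rewrite /frank /= !cats0 => r.
suff gen u h : raises u h -> forall c d, is_col c -> is_col d -> c ++ d = u ->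
    icol (size c) ++ icol (size d) = h ->
    exists d' c', [/\ is_col d' /\ is_col c', size d' = size d, size c' = size c &
                      knuth (c ++ d) (d' ++ c')] by exact: (gen _ _ r c d hc hd erefl erefl).
move=> {c d hc hd r}; elim=> {u h} [v|i v u h i0 E _ IH] c d hc hd Eu Eh.
  exists (icol (size d)), (icol (size c)); rewrite !icol_is_col !size_icol Eu -Eh.
  by split=> //; exact: knuth_icol_swap.
have hcd : all is_col [:: c; d] by rewrite /= hc hd.
have E' : raise i (flatten [:: c; d]) = Some u by rewrite /= cats0 Eu.
have [[|c1 [|d1 [|? ?]]] [//= /and3P[hc1 hd1 _] [sc sd] Eu1]] := raise_cols i0 hcd E'.
rewrite cats0 in Eu1.
have [|d2 [c2 [[hd2 hc2] sd2 sc2 kn]]] := IH c1 d1 hc1 hd1 (esym Eu1).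
  by rewrite sc sd.
have E2 := raise_lower E; rewrite Eu1 in E2.
have [v' Ev' kn'] := knuth_lower kn E2.
have hdc : all is_col [:: d2; c2] by rewrite /= hc2 hd2.
have E3 : lower i (flatten [:: d2; c2]) = Some v' by rewrite /= cats0.
have [[|d3 [|c3 [|? ?]]] [//= /and3P[hd3 hc3 _] [sd3 sc3] Ev]] := lower_cols hdc E3.
rewrite cats0 in Ev.
by exists d3, c3; rewrite sd3 sc3 sd2 sc2 -Ev Eu.
Qed.

(** * Decreasing subsequences *)

Definition dec_bound (lo m : nat) (v : seq nat) : Prop :=
  forall s, subseq s v -> sorted gtn s -> all (leq lo) s -> size s <= m.

Lemma subseq_catE (T : eqType) (s u v : seq T) : subseq s (u ++ v) ->
  exists s1 s2, [/\ s = s1 ++ s2, subseq s1 u & subseq s2 v].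
Proof.
case/subseqP=> m sm ->; exists (mask (take (size u) m) u), (mask (drop (size u) m) v).
rewrite !mask_subseq -mask_cat ?cat_take_drop //.
by rewrite size_takel // sm size_cat leq_addr.
Qed.

Lemma subseq3 (x y z : nat) s : subseq s [:: x; y; z] -> sorted gtn s ->
  s = [::] \/ s = [:: x] \/ s = [:: y] \/ s = [:: z] \/ s = [:: x; y] /\ y < x \/
  s = [:: x; z] /\ z < x \/ s = [:: y; z] /\ z < y \/ s = [:: x; y; z] /\ z < y < x.
Proof.
case/subseqP=> -[|[] [|[] [|[] [|? ?]]]] //= _ -> /=; rewrite ?andbT => ss; try tauto.
by do 7 right; rewrite andbC.
Qed.

Ltac dec_witness s :=
  exists s; split=> [|||t|t];
  [ solve [ exact: (mask_subseq [:: false; false; false] [:: _; _; _])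
    | exact: (mask_subseq [:: true; false; false] [:: _; _; _])
    | exact: (mask_subseq [:: false; true; false] [:: _; _; _])
    | exact: (mask_subseq [:: false; false; true] [:: _; _; _])
    | exact: (mask_subseq [:: true; true; false] [:: _; _; _])
    | exact: (mask_subseq [:: true; false; true] [:: _; _; _])
    | exact: (mask_subseq [:: false; true; true] [:: _; _; _])]
  | rewrite /=; lia | by [] | rewrite /=; lia | rewrite /=; lia].

(** Only the pair [z > x] occurs on one side of a rule alone.  On the other side
    it is replaced by [z > y] for the first rule and by [y > x] for the second
    one, which respects all bounds. *)
Lemma knuth_rule_dec u v s : knuth_rule u v \/ knuth_rule v u ->
  subseq s u -> sorted gtn s -> exists s', [/\ subseq s' v, sorted gtn s', size s' = size s,
  forall x, all (fun y => y < x) s -> all (fun y => y < x) s' &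
  forall x, all (fun y => x <= y) s -> all (fun y => x <= y) s'].
Proof.
case=> -[] x y z xyz /subseq3 H /H {H}.
1-4: case=> [->|[->|[->|[->|[[-> lt]|[[-> lt]|[[-> lt]|[-> lt]]]]]]]]; try (exfalso; lia);
  first [dec_witness (@nil nat) | dec_witness [:: x] | dec_witness [:: y] | dec_witness [:: z]
   | dec_witness [:: z; y] | dec_witness [:: y; x] ].
Qed.

Lemma knuth_dec lo m u v : knuth u v -> dec_bound lo m u <-> dec_bound lo m v.
Proof.
elim=> {u v} [l r u v uv|u|u v _ IH|v u w _ IH1 _ IH2]; last 3 first.
- by [].
- exact: iff_sym.
- exact: iff_trans IH1 IH2.
have H u' v' : knuth_rule u' v' \/ knuth_rule v' u' ->
    dec_bound lo m (l ++ v' ++ r) -> dec_bound lo m (l ++ u' ++ r).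
  move=> uv' B s /subseq_catE[s1 [s2 [-> sl /subseq_catE[s3 [s4 [-> su sr]]]]]].
  rewrite !(sorted_pairwise gtn_trans) !pairwise_cat allrel_catr.
  rewrite -!(sorted_pairwise gtn_trans).
  case/and3P=> /andP[a13 a14] p1 /and3P[a34 p3 p4].
  have [s' [ss' ps' Es' H1 H2]] := knuth_rule_dec uv' su p3.
  rewrite !all_cat => /and3P[b1 b3 b4].
  have -> : size (s1 ++ s3 ++ s4) = size (s1 ++ s' ++ s4) by rewrite !size_cat Es'.
  apply: B; first by rewrite !cat_subseq.
    rewrite (sorted_pairwise gtn_trans) !pairwise_cat allrel_catr.
    rewrite -!(sorted_pairwise gtn_trans) a14 p1 ps' p4 !andbT.
    apply/andP; split.
      by apply/allrelP => x y xs ys; move: y ys; apply/allP/H1/allP => y ys; apply: (allrelP a13).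
    apply/allrelP => y x ys xs; move: y ys; apply/allP/(H2 x.+1)/allP => y ys.
    exact: (allrelP a34).
  rewrite !all_cat b1 b4 andbT.
  exact: H2.
split; apply: H; [by right | by left].
Qed.

Definition count_ge (k : nat) (c : seq nat) : nat := count (leq k) c.

Definition count_in (lo hi : nat) (c : seq nat) : nat :=
  count (fun x => lo <= x < hi) c.

Lemma count_ge_lt k c : count_ge k c + count_lt k c = size c.
Proof.
rewrite -(count_predC (leq k) c); congr (_ + _); apply: eq_count => x /=.
by rewrite -ltnNge.
Qed.

Lemma count_ge_in k s c : k <= s -> count_ge k c = count_ge s c + count_in k s c.
Proof. by move=> ks; rewrite /count_ge /count_in; elim: c => //= x c ->; lia. Qed.

Lemma count_in0 s c : count_in 0 s c = count_lt s c.
Proof. by []. Qed.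

(** A decreasing subsequence of [c ++ d] consists of large letters of [c] and
    small letters of [d]. *)
Lemma dec_bound_pair k m c d : is_col c -> is_col d ->
  dec_bound k m (c ++ d) <->
  (forall s, k <= s -> count_ge s c + count_in k s d <= m).
Proof.
move=> /andP[sc _] /andP[sd _]; split=> [B s ks|H s].
  have := B (filter (leq s) c ++ filter (fun x => k <= x < s) d).
  rewrite size_cat !size_filter; apply.
  - by rewrite cat_subseq ?filter_subseq.
  - rewrite (sorted_pairwise gtn_trans) pairwise_cat -!(sorted_pairwise gtn_trans).
    rewrite !(sorted_filter gtn_trans) // !andbT; apply/allrelP => x y.
    by rewrite !mem_filter => /andP[sx _] /andP[/andP[_ ys] _] /=; lia.
  - rewrite all_cat; apply/andP; split; apply/allP => x; rewrite mem_filter => /andP[h _].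
      exact: leq_trans h.
    by case/andP: h.
case/subseq_catE=> s1 [s2 [-> ss1 ss2]].
rewrite (sorted_pairwise gtn_trans) pairwise_cat -!(sorted_pairwise gtn_trans).
move=> /and3P[a12 _ p2]; rewrite all_cat size_cat => /andP[b1 b2].
have sub (P : pred nat) t e : all P t -> subseq t e -> size t <= count P e.
  move=> /all_filterP E te; rewrite -{1}E size_filter; exact: leq_count_subseq.
case: s2 ss2 a12 p2 b2 => [|t s2] ss2 a12 p2 b2.
  apply: leq_trans _ (H k (leqnn k)); rewrite /= addn0; apply: leq_trans _ (leq_addr _ _).
  exact: sub b1 ss1.
have kt : k <= t by case/andP: b2.
apply: leq_trans _ (H t.+1 (leqW kt)); apply: leq_add.
  by apply: sub ss1; apply/allP => x xs; apply: (allrelP a12) => //; rewrite mem_head.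
apply: sub ss2; apply/allP => x xs; rewrite (allP b2) //=.
move: xs; rewrite inE => /orP[/eqP -> //|xs]; apply: ltnW.
by rewrite ltnS; have /allP := order_path_min gtn_trans p2; apply.
Qed.

(** In the word [d' ++ c'], the entries of [c'] from [k] on are a decreasing
    subsequence. *)
Lemma swap_upper k m c d d' c' : is_col c -> is_col d -> is_col c' ->
  knuth (c ++ d) (d' ++ c') ->
  (forall s, k <= s -> count_ge s c + count_in k s d <= m) -> count_ge k c' <= m.
Proof.
move=> hc hd /andP[sc' _] kn /(dec_bound_pair k m hc hd) /(knuth_dec _ _ kn) B.
have := B (filter (leq k) c'); rewrite size_filter; apply.
- apply: subseq_trans (filter_subseq _ _) _; exact: suffix_subseq.
- exact: (sorted_filter gtn_trans).
- exact: filter_all.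
Qed.

(** As [c] dominates [d], no decreasing subsequence of the word is longer than
    [c].  Hence [d'] has at most as many entries from [t] on as [c'], for each
    [t]: otherwise these entries, followed by the entries of [c'] below [t],
    would be longer.  So the decreasing subsequences of [d' ++ c'] with letters
    from [k] on are at most as long as the part of [c'] from [k] on. *)
Lemma swap_lower k s c d d' c' : is_col c -> is_col d -> is_col c' -> is_col d' ->
  knuth (c ++ d) (d' ++ c') -> size c' = size c -> dominates c d -> k <= s ->
  count_ge s c + count_in k s d <= count_ge k c'.
Proof.
move=> hc hd hc' hd' kn sz cd ks.
have B0 : dec_bound 0 (size c) (c ++ d).
  apply/dec_bound_pair => // t _; rewrite count_in0 -(count_ge_lt t c).
  by rewrite leq_add2l.
move: B0 => /(knuth_dec _ _ kn) /(dec_bound_pair _ _ hd' hc') B0.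
move: s ks; apply/(dec_bound_pair _ _ hc hd)/(knuth_dec _ _ kn).
apply/(dec_bound_pair _ _ hd' hc') => t kt; rewrite (count_ge_in _ kt) leq_add2r.
by have := B0 t (leq0n t); rewrite count_in0 -sz -(count_ge_lt t c') leq_add2r.
Qed.

(** * Moving a column through a frank list *)

Lemma shape_cat (cs ds : seq (seq nat)) : shape (cs ++ ds) = shape cs ++ shape ds.
Proof. exact: map_cat. Qed.

Lemma shape_rcons (cs : seq (seq nat)) c : shape (rcons cs c) = rcons (shape cs) (size c).
Proof. exact: map_rcons. Qed.

(** Parts of frank lists are frank, so that the column can be exchanged with its
    neighbours one after the other. *)
Lemma move_right (g : nat -> nat) a r :
  all is_col (a :: r) -> frank (a :: r) -> sorted geq (shape (a :: r)) ->
  (forall k, count_ge k a <= g k) ->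
  (forall b a', b \in r -> is_col a' -> size a' = size a -> dominates a' b ->
     (forall k, count_ge k a' <= g k) ->
     forall k s, k <= s -> count_ge s a' + count_in k s b <= g k) ->
  exists r' a', [/\ all is_col (rcons r' a'), shape (rcons r' a') = rcons (shape r) (size a),
     knuth (flatten (a :: r)) (flatten (rcons r' a')) & forall k, count_ge k a' <= g k].
Proof.
elim: r a => [|b r IH] a /= hc fr so ga H.
  exists [::], a; split=> //; exact: knuth_refl.
have /and3P[ha hb hr] := hc.
have /(@frank_cat [:: a; b]) [fab _] := fr.
have [ab _] : straight_cols [:: a; b].
  apply: frank_sorted_straight fab _; first by rewrite /= ha hb.
  by move: so => /= /andP[-> _].
have [b' [a1 [[hb' ha1] sb sa kn]]] := frank_swap ha hb fab.
have kn1 : knuth (flatten [:: a, b & r]) (flatten [:: b', a1 & r]).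
  by rewrite /= !catA; apply: knuth_catr.
have fr1 : frank (a1 :: r).
  suff /(@frank_cat [:: b']) [] : frank [:: b', a1 & r] by [].
  apply: frank_transfer fr kn1 _; rewrite /= ?ha ?hb ?hb' ?ha1 //.
  rewrite sa sb; apply/permPl; exact: (perm_catCA [:: _] [:: _]).
have ga1 k : count_ge k a1 <= g k.
  apply: swap_upper kn _ => // s ks.
  by apply: H => //; rewrite mem_head.
have [|||r' [a2 [h2 s2 k2 g2]]] := IH a1 _ fr1 _ ga1.
- by rewrite /= ha1.
- have so' : sorted geq [:: size a, size b & shape r] by [].
  rewrite /= sa; apply: (@subseq_sorted _ geq geq_trans (size a :: shape r) _ _ so').
  by rewrite -[_ :: shape r]cat1s -[X in subseq _ X]cat1s cat_subseq // subseq_cons.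
- by move=> d a' dr ha' sa'; apply: H => //; rewrite ?inE ?dr ?orbT // sa'.
exists (b' :: r'), a2; rewrite /= hb' h2; split=> //.
  by rewrite -/(shape _) s2 sb sa.
by apply: knuth_trans kn1 _; apply: knuth_catl.
Qed.

(** The column [c] moves to the left across the shorter columns.  The last
    exchange, with the column which is finally next to it, already gives the
    bound, since the previous ones only made the column smaller. *)
Lemma insert_col u c : all is_col (rcons u c) -> frank (rcons u c) -> sorted geq (shape u) ->
  exists l a r, [/\ all is_col (l ++ a :: r), sorted geq (shape (l ++ a :: r)),
    perm_eq (shape (rcons u c)) (shape (l ++ a :: r)),
    knuth (flatten (rcons u c)) (flatten (l ++ a :: r)) &
    [/\ size a = size c, r = [::] -> a = c &
    forall k s, k <= s -> count_ge s a + count_in k s (head [::] r) <= count_ge k c]].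
Proof.
elim/last_ind: u c => [|u b IH] c hc fr so.
  exists [::], c, [::]; split=> //; first exact: knuth_refl.
  by split=> // k s ks; rewrite (count_ge_in _ ks) leq_add2l.
have [cb|bc] := leqP (size c) (size b).
  exists (rcons u b), c, [::]; rewrite cats1; split=> //; last 2 first.
  - exact: knuth_refl.
  - by split=> // k s ks; rewrite (count_ge_in _ ks) leq_add2l.
  move: so; rewrite !shape_rcons; case: (shape u) => /= [_|m sh]; first by rewrite andbT.
  by rewrite !rcons_path last_rcons => ->.
have [hu hb hcc] : [/\ all is_col u, is_col b & is_col c].
  by move: hc; rewrite !all_rcons => /and3P[].
have Eu : rcons (rcons u b) c = u ++ [:: b; c] by rewrite -!cats1 -catA.
have fbc : frank [:: b; c] by move: fr; rewrite Eu => /frank_cat[].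
have [a [b1 [[ha hb1] sa sb kn]]] := frank_swap hb hcc fbc.
have knu : knuth (flatten (rcons (rcons u b) c)) (flatten (u ++ [:: a; b1])).
  by rewrite Eu !flatten_cat /= !cats0; apply: knuth_catl.
have pu : perm_eq (shape (rcons (rcons u b) c)) (shape (u ++ [:: a; b1])).
  rewrite Eu !shape_cat perm_cat2l /= sa sb; apply/permPl; exact: (perm_catC [:: _] [:: _]).
have h1 : all is_col (u ++ [:: a; b1]) by rewrite all_cat hu /= ha hb1.
have fr1 := frank_transfer hc h1 fr knu pu.
have [fra _] : frank (rcons u a) /\ frank [:: b1].
  by apply: frank_cat; rewrite -cats1 -catA.
have fab : frank [:: a; b1] by case: (frank_cat fr1).
have [ab _] : straight_cols [:: a; b1].
  apply: frank_sorted_straight fab _; first by rewrite /= ha hb1.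
  by rewrite /= andbT sa sb; apply: ltnW.
have low k s : k <= s -> count_ge s a + count_in k s b1 <= count_ge k c.
  by apply: swap_lower (knuth_sym kn) _ ab.
have hua : all is_col (rcons u a) by rewrite all_rcons ha.
have sou : sorted geq (shape u).
  by move: so; rewrite shape_rcons -cats1 => /cat_sorted2[].
have [l [d [r [hl sl pl kl [sd rd bd]]]]] := IH a hua fra sou.
exists l, d, (rcons r b1); rewrite -rcons_cons -rcons_cat; split.
- by rewrite all_rcons hb1.
- move: sl; rewrite shape_rcons -!cats1 !(sorted_pairwise geq_trans) pairwise_cat => ->.
  rewrite /= andbT; apply/allrelP => x y; rewrite inE -(perm_mem pl) shape_rcons mem_rcons inE.
  move=> xs /eqP ->; rewrite /geq /= sb; case/orP: xs => [/eqP ->|xs].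
    by rewrite sa ltnW.
  move: so; rewrite shape_rcons -cats1 (sorted_pairwise geq_trans) pairwise_cat.
  by case/andP=> /allrelP /(_ x (size b) xs); rewrite mem_head => /(_ isT).
- apply: perm_trans pu _; rewrite -cat_rcons cats1 !(shape_rcons _ b1).
  by rewrite -!(cats1 _ (size b1)) perm_cat2r.
- apply: knuth_trans knu _; rewrite -cat_rcons -(cats1 _ b1).
  rewrite (flatten_cat (rcons u a)) (flatten_cat (l ++ d :: r)).
  exact: knuth_catr.
- split; [by rewrite sd | by case: (r) |] => k s ks.
  case: r rd bd {hl sl pl kl} => [-> // _|e r _ bd] /=; first exact: low.
  apply: leq_trans (bd k s ks) _.
  by have := low k k (leqnn k); lia.
Qed.

Lemma sort_cols cs : all is_col cs -> frank cs -> exists ds, [/\ all is_col ds,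
  sorted geq (shape ds), perm_eq (shape cs) (shape ds) & knuth (flatten cs) (flatten ds)].
Proof.
elim/last_ind: cs => [|u c IH] hc fr; first by exists [::]; split=> //; exact: knuth_refl.
have [hcc hu] : is_col c /\ all is_col u by move: hc; rewrite all_rcons => /andP[].
have [fu _] : frank u /\ frank [:: c] by apply: frank_cat; rewrite cats1.
have [ds [hd sd pd kd]] := IH hu fu.
have hdc : all is_col (rcons ds c) by rewrite all_rcons hcc.
have kn : knuth (flatten (rcons u c)) (flatten (rcons ds c)).
  by rewrite -!cats1 !flatten_cat; apply: knuth_catr.
have pe : perm_eq (shape (rcons u c)) (shape (rcons ds c)).
  by rewrite !shape_rcons -!cats1 perm_cat2r.
have [l [a [r [h1 h2 h3 h4 _]]]] := insert_col hdc (frank_transfer hc hdc fr kn pe) sd.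
exists (l ++ a :: r); split=> //; [exact: perm_trans pe h3|exact: knuth_trans kn h4].
Qed.

Lemma frank_last_col u c : all is_col (rcons u c) -> frank (rcons u c) ->
  exists l a r, [/\ all is_col (l ++ a :: r), sorted geq (shape (l ++ a :: r)),
    perm_eq (shape (rcons u c)) (shape (l ++ a :: r)),
    knuth (flatten (rcons u c)) (flatten (l ++ a :: r)) &
    size a = size c /\
    forall k s, k <= s -> count_ge s a + count_in k s (head [::] r) <= count_ge k c].
Proof.
move=> hc fr.
have [hcc hu] : is_col c /\ all is_col u by move: hc; rewrite all_rcons => /andP[].
have [fu _] : frank u /\ frank [:: c] by apply: frank_cat; rewrite cats1.
have [ds [hd sd pd kd]] := sort_cols hu fu.
have hdc : all is_col (rcons ds c) by rewrite all_rcons hcc.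
have kn : knuth (flatten (rcons u c)) (flatten (rcons ds c)).
  by rewrite -!cats1 !flatten_cat; apply: knuth_catr.
have pe : perm_eq (shape (rcons u c)) (shape (rcons ds c)).
  by rewrite !shape_rcons -!cats1 perm_cat2r.
have [l [a [r [h1 h2 h3 h4 [h5 _ h6]]]]] := insert_col hdc (frank_transfer hc hdc fr kn pe) sd.
exists l, a, r; split=> //; [exact: perm_trans pe h3|exact: knuth_trans kn h4].
Qed.

(** * Jeu de taquin *)

Lemma partition_nth lam i k : sorted geq lam -> i <= k -> nth 0 lam k <= nth 0 lam i.
Proof.
elim: lam i k => [|m lam IH] i k so ik; first by rewrite !nth_nil.
case: i k ik => [|i] [|k] //= ik; last by apply: IH => //; apply: path_sorted so.
case: (ltnP k (size lam)) => kl; last by rewrite nth_default.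
have gt : transitive geq by move=> y x z xy yz; apply: leq_trans yz xy.
by have /allP /(_ _ (mem_nth 0 kl)) := order_path_min gt so.
Qed.

Lemma nth_partition lam : (forall i, nth 0 lam i.+1 <= nth 0 lam i) -> sorted geq lam.
Proof.
elim: lam => // m lam IH H; case: lam IH H => // k lam IH H /=.
by rewrite (H 0) /=; apply: IH => i; apply: (H i.+1).
Qed.

Lemma in_diagram_col lam i j : sorted geq lam -> in_diagram lam i j = (i < col_length lam j).
Proof.
rewrite /in_diagram /col_length; elim: lam i => [|m lam IH] i so; first by rewrite nth_nil.
have {}IH k : (j < nth 0 lam k) = (k < count (fun r => j < r) lam).
  by apply: IH; apply: path_sorted so.
case: i => [|i] /=; last first.
  rewrite IH; case: (ltnP j m) => // mj; rewrite add0n ltnNge.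
  suff -> : count (fun r => j < r) lam = 0 by [].
  apply/eqP; rewrite -leqn0 leqNgt -IH -leqNgt.
  by apply: leq_trans mj; have := partition_nth so (leq0n 1).
case: (ltnP j m) => // mj; rewrite add0n.
apply/esym/negbTE; rewrite -IH -leqNgt.
by apply: leq_trans mj; have := partition_nth so (leq0n 1).
Qed.

Lemma col_length_le lam j k : j <= k -> col_length lam k <= col_length lam j.
Proof. by move=> jk; apply: sub_count => r /=; apply: leq_ltn_trans. Qed.

(** Weak and strict increase between any two comparable boxes; in contrast to
    the local conditions this makes sense for a region with a hole. *)
Definition increasing n (D : nat -> nat -> bool) (f : nat -> nat -> nat) : Prop :=
  (forall p q, D p q -> 1 <= f p q <= n) /\
  (forall p q p' q', D p q -> D p' q' -> p <= p' -> q <= q' ->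
     f p q <= f p' q' /\ (p < p' -> f p q < f p' q')).

Lemma skew_tableau_increasing n S : skew_tableau n S -> increasing n (in_skew S) (entry S).
Proof.
case=> -[so1 so2] le bd row col; split=> // p q p' q' D1 D2 pp qq.
have Dbox a b : p <= a <= p' -> q <= b <= q' -> in_skew S a b.
  move=> /andP[pa ap] /andP[qb bq]; move: D1 D2; rewrite /in_skew /in_diagram -!leqNgt.
  move=> /andP[_ h1] /andP[h2 _].
  rewrite (leq_trans _ (partition_nth so2 ap)) ?(leq_ltn_trans bq) //=.
  exact: leq_trans (leq_trans (partition_nth so1 pa) h1) qb.
have R b : q <= b <= q' -> entry S p q <= entry S p b.
  case/andP=> qb; rewrite -(subnKC qb); elim: (b - q) => [|d IH]; first by rewrite addn0.
  rewrite addnS => bq; apply: leq_trans (IH (ltnW bq)) _.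
  by apply: row; apply: Dbox; lia.
have C a : p <= a <= p' -> entry S p q' + (a - p) <= entry S a q'.
  case/andP=> pa; rewrite -{1 3}(subnKC pa); elim: (a - p) => [|d IH]; first by rewrite !addn0.
  rewrite !addnS => ap; apply: leq_ltn_trans (IH (ltnW ap)) _.
  by apply: col; apply: Dbox; lia.
have := R q'; have := C p'; rewrite !leqnn pp qq => /(_ isT) c /(_ isT) r.
by split; [|move=> lt]; lia.
Qed.

Lemma increasing_skew_tableau n S : sorted geq (inner S) -> sorted geq (outer S) ->
  (forall i, nth 0 (inner S) i <= nth 0 (outer S) i) ->
  increasing n (in_skew S) (entry S) -> skew_tableau n S.
Proof.
move=> so1 so2 le [bd inc]; split=> // i j D1 D2.
  by have [] := inc _ _ _ _ D1 D2 (leqnn i) (leqnSn j).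
by have [_] := inc _ _ _ _ D1 D2 (leqnSn i) (leqnn j); apply.
Qed.

Section Reading.
Variables N M : nat.

Definition col_entries (D : nat -> nat -> bool) (f : nat -> nat -> nat) q :=
  [seq f p q | p <- iota 0 N & D p q].

(** The ranges of rows and columns are parameters, so that regions of different
    shapes can be compared. *)
Definition reading (D : nat -> nat -> bool) (f : nat -> nat -> nat) : seq nat :=
  flatten [seq rev (col_entries D f q) | q <- iota 0 M].

Lemma eq_reading (D D' : nat -> nat -> bool) (f f' : nat -> nat -> nat) :
  (forall p q, D p q = D' p q) ->
  (forall p q, D p q -> f p q = f' p q) -> reading D f = reading D' f'.
Proof.
move=> ED Ef; congr flatten; apply: eq_map => q; congr rev.
rewrite /col_entries -(eq_filter (fun p => ED p q)); apply/eq_in_map => p.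
by rewrite mem_filter => /andP[/Ef].
Qed.

End Reading.

Lemma filter_interval N a b : b <= N -> [seq p <- iota 0 N | a <= p < b] = iota a (b - a).
Proof.
move=> bN; apply: (sorted_eq leq_trans anti_leq).
- by apply: sorted_filter; [exact: leq_trans | exact: iota_sorted].
- exact: iota_sorted.
- apply: uniq_perm; rewrite ?filter_uniq ?iota_uniq // => x.
  by rewrite mem_filter !mem_iota; lia.
Qed.

Lemma filter_interval_hole N a b i : b <= N -> a <= i < b ->
  [seq p <- iota 0 N | (a <= p < b) && (p != i)] = iota a (i - a) ++ iota i.+1 (b - i.+1).
Proof.
move=> bN ib; apply: (sorted_eq leq_trans anti_leq).
- by apply: sorted_filter; [exact: leq_trans | exact: iota_sorted].
- rewrite (sorted_pairwise leq_trans) pairwise_cat -!(sorted_pairwise leq_trans).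
  rewrite !iota_sorted /= andbT.
  by apply/allrelP => x y; rewrite !mem_iota; lia.
- apply: uniq_perm; first by rewrite filter_uniq ?iota_uniq.
    rewrite cat_uniq !iota_uniq andbT /=; apply/hasPn => x; rewrite !mem_iota; lia.
  by move=> x; rewrite mem_filter mem_cat !mem_iota; lia.
Qed.

Lemma iota_split a b i : a <= i < b -> iota a (b - a) = iota a (i - a) ++ i :: iota i.+1 (b - i.+1).
Proof.
move=> ib; rewrite -[b - a](@subnKC (i - a)); last by lia.
rewrite iotaD subnKC; last by lia.
by rewrite (_ : b - a - (i - a) = (b - i.+1).+1) //; lia.
Qed.

Section HoleSlide.
Variables (n : nat) (mu nu : seq nat).
Hypotheses (somu : sorted geq mu) (sonu : sorted geq nu).

Definition region p q := in_diagram nu p q && ~~ in_diagram mu p q.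
Definition punctured i j p q := region p q && ((p, q) != (i, j)).

Lemma regionE p q : region p q = (col_length mu q <= p < col_length nu q).
Proof. by rewrite /region !in_diagram_col // -leqNgt andbC. Qed.

Lemma region_right i j : region i j -> in_diagram nu i j.+1 -> region i j.+1.
Proof.
by rewrite /region /in_diagram -!leqNgt => /andP[_ h] ->; apply: leqW.
Qed.

Lemma region_down i j : region i j -> in_diagram nu i.+1 j -> region i.+1 j.
Proof.
rewrite /region /in_diagram -!leqNgt => /andP[_ h] ->; apply: leq_trans h.
exact: partition_nth.
Qed.

Lemma region_between i j p q p' q' : region i j -> region p' q' ->
  i <= p <= p' -> j <= q <= q' -> region p q.
Proof.
rewrite !regionE => /andP[h1 _] /andP[_ h2] /andP[ip pp] /andP[jq qq].
rewrite (leq_trans (leq_trans (col_length_le mu jq) h1) ip) /=.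
exact: leq_ltn_trans pp (leq_trans h2 (col_length_le nu qq)).
Qed.

Lemma neq_suc m : (m.+1 == m) = false.
Proof. by apply/eqP; lia. Qed.

Definition move (f : nat -> nat -> nat) i j x : nat -> nat -> nat :=
  fun a b => if (a == i) && (b == j) then x else f a b.

(** The neighbour which moves is the smaller one, and the lower one if both are
    equal, so that it stands in the right relation to the other neighbour, and
    to all boxes beyond it. *)
Lemma increasing_move i j i' j' f :
  region i j -> region i' j' -> (i', j') = (i, j.+1) \/ (i', j') = (i.+1, j) ->
  (i' = i -> in_diagram nu i.+1 j -> f i j.+1 < f i.+1 j) ->
  (j' = j -> in_diagram nu i j.+1 -> f i.+1 j <= f i j.+1) ->
  increasing n (punctured i j) f ->
  increasing n (punctured i' j') (move f i j (f i' j')).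
Proof.
move=> Dij Dij' adj right down [bd inc].
have P' : punctured i j i' j'.
  by rewrite /punctured Dij' /=; case: adj => -[-> ->]; apply/eqP => -[]; lia.
have Pother a b : punctured i' j' a b -> (a, b) != (i, j) -> punctured i j a b.
  by rewrite /punctured => /andP[-> _].
split=> [p q D|p q p' q' D1 D2 pp qq].
  rewrite /move; case: ifP => [_|ne]; first exact: bd.
  by apply: bd; apply: Pother D _; rewrite xpair_eqE ne.
have inD a b : region a b -> (a, b) != (i, j) -> punctured i j a b by move=> h1 h2; apply/andP.
have Q1 : (p, q) != (i, j) -> punctured i j p q by apply: Pother.
have Q2 : (p', q') != (i, j) -> punctured i j p' q' by apply: Pother.
have [R2 n2] : region p' q' /\ (p', q') != (i', j') by case/andP: D2.
rewrite /move -!xpair_eqE; case: eqP Q1 => [[Ep Eq] _|_ /(_ isT) Q1];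
  case: eqP Q2 => [[Ep' Eq']|ne'] Q2.
- by rewrite Ep Ep' ltnn.
- have {}Q2 := Q2 isT; rewrite {}Ep {}Eq {D1} in pp qq *.
  have Rj : i < p' -> region i.+1 j.
    by move=> ip; apply: region_between Dij R2 _ _; rewrite ?leqnSn ?leqnn.
  have Ri : j < q' -> region i j.+1.
    by move=> jq; apply: region_between Dij R2 _ _; rewrite ?leqnSn ?leqnn.
  case: adj => -[Ei Ej]; rewrite Ei Ej in P' n2 right down *.
    have [jq|qj] := ltnP j q'; first by apply: inc.
    have Eq : q' = j by apply/eqP; rewrite eqn_leq qj qq.
    have ip : i < p' by case: (ltngtP i p') pp => // E; case: ne'; rewrite E Eq.
    have Rd := Rj ip; have := right erefl; case/andP: (Rd) => -> _ /(_ isT) lt.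
    have Pd : punctured i j i.+1 j by apply: inD => //; rewrite xpair_eqE neq_suc ?andbF.
    have [le _] := inc _ _ _ _ Pd Q2 ip qq.
    by split=> [|_]; [apply: ltnW|]; apply: leq_trans lt le.
  have lej : j < q' -> f i.+1 j <= f i j.+1 /\ punctured i j i j.+1.
    move=> jq; have Rr := Ri jq; have := down erefl; case/andP: (Rr) => -> _ /(_ isT) ->.
    by split=> //; apply: inD => //; rewrite xpair_eqE neq_suc ?andbF.
  have [ip|pi] := ltnP i p'.
    have [le lt] := inc _ _ _ _ P' Q2 ip qq.
    split=> // _; case: (ltngtP i.+1 p') ip => // Ep _; first exact: lt.
    have jq : j < q' by case: (ltngtP j q') qq => // E; move: n2; rewrite E Ep eqxx.
    have [le1 P1] := lej jq; apply: leq_ltn_trans le1 _.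
    by have [_] := inc _ _ _ _ P1 Q2 pp jq; apply; rewrite -Ep.
  have Ep : p' = i by apply/eqP; rewrite eqn_leq pi pp.
  have jq : j < q' by case: (ltngtP j q') qq => // E; case: ne'; rewrite E Ep.
  have [le1 P1] := lej jq; have [le2 _] := inc _ _ _ _ P1 Q2 pp jq.
  split; [exact: leq_trans le1 le2 | by []].
- rewrite Ep' Eq' in pp qq *.
  have [pi' qj'] : i <= i' /\ j <= j' by case: adj => -[-> ->].
  have [le lt] := inc _ _ _ _ Q1 P' (leq_trans pp pi') (leq_trans qq qj').
  by split=> // pi; apply: lt; apply: leq_trans pi pi'.
- by apply: inc => //; apply: Q2.
Qed.

Lemma col_entries_sorted N D f q : increasing n D f -> sorted ltn (col_entries N D f q).
Proof.
case=> _ inc; apply: (homo_sorted_in (P := D^~ q) (e := ltn)).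
- by move=> p p' D1 D2 pp; have [_] := inc _ _ _ _ D1 D2 (ltnW pp) (leqnn q); apply.
- exact: filter_all.
- by apply: sorted_filter; [exact: ltn_trans | exact: iota_ltn_sorted].
Qed.

Lemma col_entries_full N f i j q : size nu <= N -> q != j ->
  col_entries N (punctured i j) f q =
  [seq f p q | p <- iota (col_length mu q) (col_length nu q - col_length mu q)].
Proof.
move=> nuN qj; rewrite /col_entries -(filter_interval _ (N := N)); last first.
  exact: leq_trans (count_size _ _) nuN.
congr map; apply: eq_filter => p; rewrite /punctured regionE xpair_eqE (negPf qj).
by rewrite andbF andbT.
Qed.

Lemma col_entries_hole N f i j : size nu <= N -> region i j ->
  col_entries N (punctured i j) f j =
  [seq f p j | p <- iota (col_length mu j) (i - col_length mu j)] ++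
  [seq f p j | p <- iota i.+1 (col_length nu j - i.+1)].
Proof.
move=> nuN; rewrite regionE => ib; rewrite -map_cat -(filter_interval_hole (N := N)) //; last first.
  exact: leq_trans (count_size _ _) nuN.
congr map; apply: eq_filter => p; rewrite /punctured regionE xpair_eqE eqxx.
by rewrite andbT.
Qed.

Lemma reading_split N M D f j : j.+1 < M -> reading N M D f =
  flatten [seq rev (col_entries N D f q) | q <- iota 0 j] ++
  (rev (col_entries N D f j) ++ rev (col_entries N D f j.+1)) ++
  flatten [seq rev (col_entries N D f q) | q <- iota j.+2 (M - j.+2)].
Proof.
move=> jM; have E : iota 0 M = iota 0 j ++ [:: j; j.+1] ++ iota j.+2 (M - j.+2).
  by rewrite -{1}(subnKC jM) iotaD -{1}[j.+2]addn2 iotaD -catA.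
by rewrite /reading E !map_cat !flatten_cat /= cats0.
Qed.

Lemma move_other f i j x p q : (p, q) != (i, j) -> move f i j x p q = f p q.
Proof. by rewrite xpair_eqE /move => /negPf ->. Qed.

(** Only the columns [j] and [j.+1] change. *)
Lemma reading_right N M i j f : size nu <= N -> j.+1 < M ->
  region i j -> region i j.+1 ->
  increasing n (punctured i j) f ->
  increasing n (punctured i j.+1) (move f i j (f i j.+1)) ->
  knuth (reading N M (punctured i j) f)
        (reading N M (punctured i j.+1) (move f i j (f i j.+1))).
Proof.
move=> nuN jM R1 R2 inc1 inc2; set f' := move _ _ _ _.
rewrite !(reading_split _ _ _ jM).
have same q : q != j -> q != j.+1 ->
    col_entries N (punctured i j.+1) f' q = col_entries N (punctured i j) f q.
  move=> q1 q2; rewrite !col_entries_full //; apply: eq_map => p.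
  by rewrite /f' move_other // xpair_eqE (negPf q1) andbF.
have -> : [seq rev (col_entries N (punctured i j.+1) f' q) | q <- iota 0 j] =
    [seq rev (col_entries N (punctured i j) f q) | q <- iota 0 j].
  by apply/eq_in_map => q; rewrite mem_iota => qj; rewrite same //; lia.
have -> : [seq rev (col_entries N (punctured i j.+1) f' q) | q <- iota j.+2 (M - j.+2)] =
    [seq rev (col_entries N (punctured i j) f q) | q <- iota j.+2 (M - j.+2)].
  by apply/eq_in_map => q; rewrite mem_iota => qj; rewrite same //; lia.
apply: knuth_ctx.
have so1 : sorted ltn (col_entries N (punctured i j) f j.+1) by apply: col_entries_sorted inc1.
have so2 : sorted ltn (col_entries N (punctured i j.+1) f' j) by apply: col_entries_sorted inc2.
have [I1 I2] : i < col_length nu j /\ col_length mu j <= i.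
  by move: R1; rewrite regionE => /andP[].
have [I3 I4] : i < col_length nu j.+1 /\ col_length mu j.+1 <= i.
  by move: R2; rewrite regionE => /andP[].
have mle := col_length_le mu (leqnSn j); have nle := col_length_le nu (leqnSn j).
move: so1 so2; rewrite (@col_entries_full N f' i j.+1 j) ?(@col_entries_full N f i j j.+1) //;
  try by rewrite ?neq_suc // eq_sym neq_suc.
rewrite !col_entries_hole //.
rewrite (iota_split (i := i) (a := col_length mu j)) ?I1 ?I2 //.
rewrite (iota_split (i := i) (a := col_length mu j.+1)) ?I3 ?I4 //.
rewrite !map_cat /=.
have E1 q s : (i \notin s) -> [seq f' p q | p <- s] = [seq f p q | p <- s].
  move=> is_; apply/eq_in_map => p ps; rewrite /f' move_other // xpair_eqE.
  by case: eqP ps is_ => // -> ->.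
have E2 s : [seq f' p j.+1 | p <- s] = [seq f p j.+1 | p <- s].
  by apply: eq_map => p; rewrite /f' move_other // xpair_eqE; lia.
rewrite !E2 !E1 ?mem_iota; try lia.
rewrite (_ : f' i j = f i j.+1); last by rewrite /f' /move !eqxx.
rewrite !rev_cat !rev_cons -!cats1 -!catA !cat1s.
set A1 := [seq _ | p <- iota _ (i - col_length mu j)].
set A2 := [seq _ | p <- iota i.+1 (col_length nu j - _)].
set B1 := [seq _ | p <- iota _ (i - col_length mu j.+1)].
set B2 := [seq _ | p <- iota i.+1 (col_length nu j.+1 - _)].
move=> so1 so2.
have P1 p : col_length mu j <= p < col_length nu j -> p != i -> punctured i j p j.
  by move=> h pi; rewrite /punctured regionE h xpair_eqE (negPf pi).
have P2 p : col_length mu j.+1 <= p < col_length nu j.+1 -> punctured i j p j.+1.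
  by move=> h; rewrite /punctured regionE h xpair_eqE; lia.
have [_ inc] := inc1.
apply: knuth_horizontal.
- have : sorted gtn (rev (A1 ++ f i j.+1 :: A2)) by rewrite rev_sorted.
  by rewrite rev_cat rev_cons -cats1 -catA.
- have : sorted gtn (rev (B1 ++ f i j.+1 :: B2)) by rewrite rev_sorted.
  by rewrite rev_cat rev_cons -cats1 -catA.
- move=> k; rewrite size_rev => kA; have kB : k < size B1.
    by move: kA; rewrite !size_map !size_iota; lia.
  rewrite !nth_rev // !size_map !size_iota; move: kA kB; rewrite !size_map !size_iota => kA kB.
  rewrite !(nth_map 0) ?size_iota ?nth_iota; try lia.
  rewrite (_ : col_length mu j.+1 + _ = col_length mu j + (i - col_length mu j - k.+1));
    last by lia.
  by have [] := inc _ _ _ _ (P1 (col_length mu j + (i - col_length mu j - k.+1)) _ _)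
    (P2 (col_length mu j + (i - col_length mu j - k.+1)) _) (leqnn _) (leqnSn j); lia.
- by rewrite !size_rev !size_map !size_iota; lia.
- move=> k; rewrite size_rev !revK => kB; have kA : k < size A2.
    by move: kB; rewrite !size_map !size_iota; lia.
  move: kA kB; rewrite !size_map !size_iota => kA kB.
  rewrite !(nth_map 0) ?size_iota ?nth_iota; try lia.
  by have [] := inc _ _ _ _ (P1 (i.+1 + k) _ _) (P2 (i.+1 + k) _) (leqnn _) (leqnSn j); lia.
- by rewrite !size_rev !size_map !size_iota; lia.
Qed.

Lemma reading_down N M i j f : size nu <= N -> region i j -> region i.+1 j ->
  reading N M (punctured i j) f =
  reading N M (punctured i.+1 j) (move f i j (f i.+1 j)).
Proof.
move=> nuN R1 R2; congr flatten; apply: eq_map => q; congr rev.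
have [->|qj] := eqVneq q j; last first.
  rewrite !col_entries_full //; apply: eq_map => p.
  by rewrite move_other // xpair_eqE (negPf qj) andbF.
rewrite !col_entries_hole //.
move: R1 R2; rewrite !regionE => R1 R2.
rewrite (_ : i.+1 - col_length mu j = (i - col_length mu j) + 1); last by lia.
rewrite iotaD map_cat -catA (_ : col_length mu j + _ = i); last by lia.
rewrite (_ : col_length nu j - i.+1 = (col_length nu j - i.+2).+1) /=; last by lia.
rewrite {2}/move !eqxx /=; congr (_ ++ _ :: _); apply/eq_in_map => p; rewrite mem_iota => pb;
  by rewrite move_other // xpair_eqE; lia.
Qed.

(** A move to the right is a Knuth equivalence of the reading words, and a move
    upwards does not change them. *)
Lemma hole_slide_increasing N M i j f nu' f' : size nu <= N -> head 0 nu <= M ->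
  hole_slide nu i j f nu' f' -> region i j -> increasing n (punctured i j) f ->
  exists i' j', [/\ region i' j', ~~ in_diagram nu i' j'.+1 /\ ~~ in_diagram nu i'.+1 j',
    nu' = set_nth 0 nu i' j', increasing n (punctured i' j') f' &
    knuth (reading N M (punctured i j) f) (reading N M (punctured i' j') f')].
Proof.
move=> nuN nuM.
elim=> {i j f nu' f'}
  [i j f c1 c2|i j f nu' f' c1 c2 _ IH|i j f nu' f' c1 c2 _ IH] R inc.
- by exists i, j; split=> //; exact: knuth_refl.
- have R' := region_right R c1.
  have inc' : increasing n (punctured i j.+1) (move f i j (f i j.+1)).
    by apply: increasing_move => //; [left | lia].
  have [i' [j' [h1 h2 h3 h4 h5]]] := IH R' inc'; exists i', j'; split=> //.
  apply: knuth_trans h5; apply: reading_right => //.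
  apply: leq_trans nuM; move: c1; rewrite /in_diagram -nth0 => c1.
  exact: leq_trans c1 (partition_nth sonu (leq0n i)).
- have R' := region_down R c1.
  have inc' : increasing n (punctured i.+1 j) (move f i j (f i.+1 j)).
    by apply: increasing_move => //; [right | lia].
  have [i' [j' [h1 h2 h3 h4 h5]]] := IH R' inc'; exists i', j'; split=> //.
  by rewrite (@reading_down N M i j f nuN R R').
Qed.

Lemma in_diagram_bound i j : in_diagram nu i j -> i < size nu /\ j < head 0 nu.
Proof.
rewrite /in_diagram => h; split.
  by rewrite ltnNge; apply/negP => si; rewrite nth_default in h.
by rewrite -nth0; apply: leq_trans h (partition_nth sonu (leq0n i)).
Qed.

Lemma hole_slide_exists i j f : exists nu' f', hole_slide nu i j f nu' f'.
Proof.
have [m] := ubnP ((size nu - i) + (head 0 nu - j)).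
elim: m i j f => // m IH i j f le.
case: (boolP (in_diagram nu i j.+1)) => c1; case: (boolP (in_diagram nu i.+1 j)) => c2.
- have [b1 b2] := (in_diagram_bound c1, in_diagram_bound c2).
  case: (leqP (f i.+1 j) (f i j.+1)) => cmp.
    have [|nu' [f' h]] := IH i.+1 j (move f i j (f i.+1 j)); first by lia.
    by exists nu', f'; apply: hole_down.
  have [|nu' [f' h]] := IH i j.+1 (move f i j (f i j.+1)); first by lia.
  by exists nu', f'; apply: hole_right.
- have b1 := in_diagram_bound c1.
  have [|nu' [f' h]] := IH i j.+1 (move f i j (f i j.+1)); first by lia.
  by exists nu', f'; apply: hole_right => //; rewrite (negPf c2).
- have b2 := in_diagram_bound c2.
  have [|nu' [f' h]] := IH i.+1 j (move f i j (f i.+1 j)); first by lia.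
  by exists nu', f'; apply: hole_down => //; rewrite (negPf c1).
- by exists (set_nth 0 nu i j), f; constructor.
Qed.

End HoleSlide.

Definition word (S : Defs.skew) : seq nat := flatten (map rev (columns S)).

Lemma flatten_map_nonnil (T : eqType) (f : seq T -> seq T) (cs : seq (seq T)) : f [::] = [::] ->
  flatten (map f [seq c <- cs | c != [::]]) = flatten (map f cs).
Proof. by move=> f0; elim: cs => //= c cs IH; case: eqP => [->|_] /=; rewrite ?IH ?f0. Qed.

Lemma reading_widen N M nu (D : nat -> nat -> bool) f :
  sorted geq nu -> size nu <= N -> head 0 nu <= M ->
  (forall p q, D p q -> in_diagram nu p q) ->
  reading N M D f = reading (size nu) (head 0 nu) D f.
Proof.
move=> so nuN nuM sub; rewrite /reading -{1}(subnKC nuM) iotaD map_cat flatten_cat.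
have E q : col_entries N D f q = col_entries (size nu) D f q.
  rewrite /col_entries -{1}(subnKC nuN) iotaD filter_cat map_cat.
  rewrite [X in _ ++ map _ X](_ : _ = [::]) ?cats0 //.
  apply/eqP; rewrite -[_ == _]negbK -has_filter; apply/hasPn => p; rewrite mem_iota => /andP[sp _].
  by apply/negP => /sub /(in_diagram_bound so)[]; lia.
rewrite (eq_map (fun q => congr1 rev (E q))).
rewrite [X in _ ++ X](_ : _ = [::]) ?cats0 //.
apply/eqP; rewrite -size_eq0 size_flatten sumnE big_map big1_seq // => c /=.
case/mapP=> q; rewrite mem_iota => /andP[hq _] ->; rewrite size_rev size_map.
apply/eqP; rewrite size_eq0 -[_ == _]negbK -has_filter; apply/hasPn => p _.
by apply/negP => /sub /(in_diagram_bound so)[]; rewrite add0n in hq; lia.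
Qed.

Lemma word_reading N M S : sorted geq (outer S) -> size (outer S) <= N ->
  head 0 (outer S) <= M -> word S = reading N M (in_skew S) (entry S).
Proof.
move=> so sN hM; rewrite (reading_widen _ so sN hM); last by move=> p q /andP[].
by rewrite /word /columns flatten_map_nonnil // -map_comp.
Qed.

(** At the start of a slide the hole is the removed box of the inner shape, and
    at its end the hole is the removed box of the outer shape. *)
Lemma slide_knuth n S S' : skew_tableau n S -> slide S S' ->
  skew_tableau n S' /\ knuth (word S) (word S').
Proof.
move=> tS [i [j [/and3P[c0 c1 c2] Ei hs]]].
have incS := skew_tableau_increasing tS.
have [[so1 so2] le _ _ _] := tS.
have nthi p : nth 0 (inner S') p = if p == i then j else nth 0 (inner S) p.
  by rewrite Ei nth_set_nth.
have so1' : sorted geq (inner S').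
  apply: nth_partition => p; rewrite !nthi.
  case: (p.+1 =P i) => [pi|_].
    rewrite (_ : (p == i) = false); last by lia.
    by apply: leq_trans (partition_nth so1 (leqnSn p)); rewrite pi ltnW.
  case: (p =P i) => [->|_]; last exact: partition_nth.
  by rewrite leqNgt.
have R0 : region (inner S') (outer S) i j.
  rewrite /region /in_diagram nthi eqxx ltnn andbT.
  exact: leq_trans c0 (le i).
have Dpunct p q : in_skew S p q = punctured (inner S') (outer S) i j p q.
  rewrite /punctured /region /in_skew /in_diagram nthi xpair_eqE.
  case: (p =P i) => [->|_]; last by rewrite andbT.
  by move: c0 c1; rewrite /in_diagram; case: (q =P j); lia.
have inc0 : increasing n (punctured (inner S') (outer S) i j) (entry S).
  case: incS => bd inc; split=> [p q|p q p' q']; rewrite -!Dpunct; [exact: bd | exact: inc].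
have [i' [j' [R' [d1 d2] Eo inc' kn]]] :=
  hole_slide_increasing so1' so2 (leqnn (size (outer S))) (leqnn (head 0 (outer S))) hs R0 inc0.
have ntho p : nth 0 (outer S') p = if p == i' then j' else nth 0 (outer S) p.
  by rewrite Eo nth_set_nth.
have /andP[e1 e2] := R'.
have Dpunct' p q : in_skew S' p q = punctured (inner S') (outer S) i' j' p q.
  rewrite /punctured /region /in_skew /in_diagram ntho xpair_eqE.
  case: (p =P i') => [->|_]; last by rewrite andbT.
  by move: e1 d1; rewrite /in_diagram; case: (q =P j'); lia.
have so2' : sorted geq (outer S').
  apply: nth_partition => p; rewrite !ntho.
  case: (p.+1 =P i') => [pi|_].
    rewrite (_ : (p == i') = false); last by lia.
    by apply: leq_trans (partition_nth so2 (leqnSn p)); rewrite pi ltnW.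
  case: (p =P i') => [->|_]; last exact: partition_nth.
  by rewrite leqNgt.
have inc2 : increasing n (in_skew S') (entry S').
  case: inc' => bd inc; split=> [p q|p q p' q']; rewrite !Dpunct'; [exact: bd | exact: inc].
have so : size (outer S') = size (outer S).
  by rewrite Eo size_set_nth; apply/maxn_idPr; case: (in_diagram_bound so2 e1).
split.
  apply: increasing_skew_tableau => // p; rewrite nthi ntho.
  have lep : (if p == i then j else nth 0 (inner S) p) <= nth 0 (outer S) p.
    by apply: leq_trans _ (le p); case: eqP => // ->; apply: ltnW.
  case: (p =P i') => // E; move: e2; rewrite /in_diagram nthi -leqNgt -E.
  by rewrite E.
rewrite (word_reading so2 (leqnn _) (leqnn _)).
rewrite (eq_reading _ _ Dpunct (fun p q _ => erefl)).
have := @word_reading (size (outer S)) (head 0 (outer S)) S' so2'.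
rewrite so => -> //; last first.
  by move: e1; rewrite -!nth0 ntho /in_diagram; case: eqP => [<- /ltnW|].
by rewrite (eq_reading _ _ Dpunct' (fun p q _ => erefl)).
Qed.

Lemma slides_knuth n S S' : clos_refl_trans Defs.skew slide S S' -> skew_tableau n S ->
  skew_tableau n S' /\ knuth (word S) (word S').
Proof.
elim=> {S S'} [S S' sl tS|S tS|S S1 S2 _ IH1 _ IH2 tS].
- exact: slide_knuth tS sl.
- by split=> //; exact: knuth_refl.
- have [t1 k1] := IH1 tS; have [t2 k2] := IH2 t1.
  by split=> //; exact: knuth_trans k1 k2.
Qed.

(** The last box of the last nonempty row is a corner. *)
Lemma inside_corner_exists mu : sorted geq mu ->
  (exists i j, inside_corner mu i j) \/ (forall i, nth 0 mu i = 0).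
Proof.
move=> so; case: (posnP (col_length mu 0)) => [c0|cp].
  right=> i; apply/eqP; rewrite -leqn0 leqNgt; apply/negP => h.
  by have := in_diagram_col i 0 so; rewrite /in_diagram h c0.
left; exists (col_length mu 0).-1, (nth 0 mu (col_length mu 0).-1).-1.
have h1 : 0 < nth 0 mu (col_length mu 0).-1.
  by have := in_diagram_col (col_length mu 0).-1 0 so; rewrite /in_diagram => ->; lia.
have h2 : nth 0 mu (col_length mu 0) = 0.
  apply/eqP; rewrite -leqn0 leqNgt.
  by have := in_diagram_col (col_length mu 0) 0 so; rewrite /in_diagram => ->; rewrite ltnn.
by rewrite /inside_corner /in_diagram !prednK // h2; lia.
Qed.

Lemma rectification_exists n S : skew_tableau n S -> exists S',
  [/\ clos_refl_trans Defs.skew slide S S', skew_tableau n S' & forall i, nth 0 (inner S') i = 0].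
Proof.
have [m] := ubnP (sumn (inner S)); elim: m S => // m IH S le tS.
have [[so1 so2] _ _ _ _] := tS.
case: (inside_corner_exists so1) => [[i [j ij]]|z]; last first.
  by exists S; split=> //; exact: rt_refl.
have [nu' [f' hs]] := hole_slide_exists so1 so2 i j (entry S).
have sl : slide S (Skew (set_nth 0 (inner S) i j) nu' f') by exists i, j.
have [t1 _] := slide_knuth tS sl.
have [|S' [r1 t2 z]] := IH _ _ t1.
  have /and3P[c0 _ _] := ij; have [si _] := in_diagram_bound so1 c0.
  have ls : nth 0 (inner S) i <= sumn (inner S).
    by rewrite [X in _ <= X]sumnE (big_rem _ (mem_nth 0 si)) leq_addr.
  by move: le c0 ls; rewrite /= sumn_set_nth_ltn // /in_diagram; lia.
by exists S'; split=> //; apply: rt_trans r1; apply: rt_step.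
Qed.

(** * From skew tableaux to lists of columns and back *)

Definition dcols (S : Defs.skew) : seq (seq nat) := map rev (columns S).

Lemma shape_map_rev (cs : seq (seq nat)) : shape (map rev cs) = shape cs.
Proof. by rewrite /shape -map_comp; apply: eq_map => c /=; rewrite size_rev. Qed.

Lemma skew_tableau_col n S q : skew_tableau n S -> sorted ltn (column S q) /\
  forall x, x \in column S q -> 1 <= x <= n.
Proof.
move=> tS; have inc := skew_tableau_increasing tS.
split; first exact: (col_entries_sorted (size (outer S)) q inc).
move=> x /mapP[p]; rewrite mem_filter => /andP[D _] ->.
by case: inc => bd _; apply: bd.
Qed.

Lemma skew_tableau_dcols n S : skew_tableau n S -> all is_col (dcols S).
Proof.
move=> tS; apply/allP => c /mapP[d]; rewrite mem_filter => /andP[_ /mapP[q _ ->]] ->.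
have [so bd] := skew_tableau_col q tS.
rewrite /is_col rev_sorted so all_rev; apply/allP => x /bd /andP[] //.
Qed.

Lemma nil_dcols S : [::] \notin dcols S.
Proof.
apply/mapP => -[c]; rewrite mem_filter => /andP[/eqP ne _] E; apply: ne.
by rewrite -[c]revK -E.
Qed.

Section NoInner.
Variables (n : nat) (S : Defs.skew).
Hypotheses (tS : skew_tableau n S) (z : forall i, nth 0 (inner S) i = 0).

Lemma in_skew_no_inner i j : in_skew S i j = in_diagram (outer S) i j.
Proof. by rewrite /in_skew {2}/in_diagram z andbT. Qed.

Lemma column_no_inner q : column S q = [seq entry S p q | p <- iota 0 (col_length (outer S) q)].
Proof.
have [[_ so] _ _ _ _] := tS.
rewrite -[X in iota 0 X]subn0 -(@filter_interval (size (outer S))); last exact: count_size.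
by congr map; apply: eq_filter => p; rewrite in_skew_no_inner in_diagram_col.
Qed.

Lemma size_column_no_inner q : size (column S q) = col_length (outer S) q.
Proof. by rewrite column_no_inner size_map size_iota. Qed.

Lemma columns_no_inner : columns S = [seq column S q | q <- iota 0 (head 0 (outer S))].
Proof.
have [[_ so] _ _ _ _] := tS.
apply/all_filterP/allP => c /mapP[q]; rewrite mem_iota => /andP[_ hq] ->.
rewrite -size_eq0 size_column_no_inner -lt0n -in_diagram_col // /in_diagram nth0.
Qed.

Lemma straight_no_inner : straight_cols (dcols S).
Proof.
have [_ inc] := skew_tableau_increasing tS.
have dm q : dominates (rev (column S q)) (rev (column S q.+1)).
  move=> s; rewrite /count_lt !count_rev !count_map !count_filter; apply: sub_count => p /=.
  rewrite !in_skew_no_inner => /andP[h D].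
  have D' : in_diagram (outer S) p q by apply: ltnW.
  rewrite D' andbT; apply: leq_ltn_trans h.
  move: D D'; rewrite -!in_skew_no_inner => D D'.
  by have [] := inc p q p q.+1 D' D (leqnn p) (leqnSn q).
rewrite /dcols columns_no_inner -map_comp; move: (head 0 (outer S)) => m.
suff H q : straight_cols [seq (rev \o column S) i | i <- iota q m] by exact: H.
elim: m q => //= m IH q; split=> //.
by case: m {IH} => [|m] /=; [exact: dominates_nil | exact: dm].
Qed.

End NoInner.

Lemma straight_tableau n lam T : semistandard n lam T ->
  skew_tableau n (straight T) /\ forall i, nth 0 (inner (straight T)) i = 0.
Proof. by case=> _ tT; split=> // i; rewrite nth_nil. Qed.

Lemma frank_with_knuth n lam T S : semistandard n lam T -> skew_tableau n S ->
  frank_with S T -> knuth (flatten (dcols S)) (flatten (dcols (straight T))) /\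
  perm_eq (shape (dcols S)) (shape (dcols (straight T))).
Proof.
move=> sT tS [[S' [r _ D E]] pe]; rewrite !shape_map_rev; split=> //.
have [tT z] := straight_tableau sT.
have [tS' kn] := slides_knuth r tS.
apply: knuth_trans kn _; rewrite -!/(word _).
have [[_ so1] _ _ _ _] := tS'; have [[_ so2] _ _ _ _] := tT.
rewrite (word_reading (N := maxn (size (outer S')) (size (shape T)))
  (M := maxn (head 0 (outer S')) (head 0 (shape T))) so1) ?leq_maxl //.
rewrite (word_reading (N := maxn (size (outer S')) (size (shape T)))
  (M := maxn (head 0 (outer S')) (head 0 (shape T))) so2) ?leq_maxr //.
rewrite (@eq_reading _ _ _ (in_skew (straight T)) _ (entry (straight T))).
- exact: knuth_refl.
- by move=> p q; rewrite D (in_skew_no_inner z).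
- exact: E.
Qed.

(** The columns occupy disjoint sets of rows, later columns being higher, so
    that the row conditions are void. *)
Fixpoint antidiagonal (cs : seq (seq nat)) : Defs.skew :=
  if cs is c :: cs' then
    let S := antidiagonal cs' in
    Skew (map succn (inner S) ++ nseq (size c) 0)
         (map succn (outer S) ++ nseq (size c) 1)
         (fun i j => if j is j'.+1 then entry S i j' else nth 0 c (i - size (outer S)))
  else Skew [::] [::] (fun _ _ => 0).

Lemma antidiagonal_size cs :
  size (inner (antidiagonal cs)) = size (outer (antidiagonal cs)).
Proof. by elim: cs => //= c cs IH; rewrite !size_cat !size_map !size_nseq IH. Qed.

Lemma antidiagonal_in_skew0 c cs i :
  in_skew (antidiagonal (c :: cs)) i 0 =
  (size (outer (antidiagonal cs)) <= i < size (outer (antidiagonal cs)) + size c).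
Proof.
rewrite /in_skew /in_diagram /= !nth_cat !size_map antidiagonal_size.
case: (ltnP i _) => ih; first by rewrite !(nth_map 0) ?antidiagonal_size.
rewrite !nth_nseq /=; case: ifP; lia.
Qed.

Lemma antidiagonal_in_skewS c cs i j :
  in_skew (antidiagonal (c :: cs)) i j.+1 = in_skew (antidiagonal cs) i j.
Proof.
rewrite /in_skew /in_diagram /= !nth_cat !size_map antidiagonal_size.
case: (ltnP i _) => ih; first by rewrite !(nth_map 0) ?antidiagonal_size ?ltnS.
rewrite !nth_nseq !(nth_default _ (s := outer _)) //.
by case: ifP.
Qed.

Lemma antidiagonal_row cs i j :
  in_skew (antidiagonal cs) i j -> ~~ in_skew (antidiagonal cs) i j.+1.
Proof.
elim: cs j => [|c cs IH] [|j]; rewrite ?/(in_skew (antidiagonal [::])) ?antidiagonal_in_skewS //.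
- by rewrite /in_skew /in_diagram /= nth_nil.
- by rewrite /in_skew /in_diagram /= nth_nil.
- rewrite antidiagonal_in_skew0 => /andP[hi _].
  by rewrite /in_skew /in_diagram (nth_default _ hi).
- exact: IH.
Qed.

Lemma antidiagonal_tableau n (cs : seq (seq nat)) :
  (forall c : seq nat, c \in cs -> sorted ltn c /\ forall x, x \in c -> 1 <= x <= n) ->
  skew_tableau n (antidiagonal cs).
Proof.
have so s k e : sorted geq s -> e <= 1 -> sorted geq (map succn s ++ nseq k e).
  move=> ss e1; rewrite (sorted_pairwise geq_trans) pairwise_cat pairwise_map.
  rewrite -[pairwise _ s]/(pairwise geq s) -(sorted_pairwise geq_trans) ss /=.
  apply/andP; split; last first.
    by elim: k => //= k ->; rewrite andbT; apply/allP => x /nseqP[-> _] /=.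
  apply/allrelP => x y /mapP[x' _ ->] /nseqP[-> _] /=; exact: leq_trans e1 _.
elim: cs => [|c cs IH] H.
  by split=> // i j; rewrite /in_skew /in_diagram /= nth_nil.
have [|[so1 so2] le bd row col] := IH; first by move=> d dc; apply: H; rewrite inE dc orbT.
have [sc bc] := H c (mem_head _ _).
split.
- by split; apply: so.
- move=> i; rewrite /= !nth_cat !size_map antidiagonal_size; case: ltnP => ih.
    by rewrite !(nth_map 0) ?antidiagonal_size // ltnS.
  by rewrite !nth_nseq; case: ifP.
- move=> i [|j]; last by rewrite antidiagonal_in_skewS; apply: bd.
  rewrite antidiagonal_in_skew0 => /andP[h1 h2] /=; apply/bc/mem_nth.
  by rewrite -(ltn_add2l (size (outer (antidiagonal cs)))) subnKC.
- by move=> i j D D'; have := antidiagonal_row D; rewrite D'.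
- move=> i [|j]; last by rewrite !antidiagonal_in_skewS; apply: col.
  rewrite !antidiagonal_in_skew0 => hi hi' /=; rewrite subSn; last by lia.
  by apply: (sorted_ltn_nth ltn_trans) => //; rewrite ?inE; lia.
Qed.

Lemma antidiagonal_column0 c cs : column (antidiagonal (c :: cs)) 0 = c.
Proof.
set h := size (outer (antidiagonal cs)).
have -> : column (antidiagonal (c :: cs)) 0 =
    [seq nth 0 c (i - h) | i <- [seq i <- iota 0 (h + size c) | h <= i < h + size c]].
  rewrite /column /= size_cat size_map size_nseq; congr map.
  by apply: eq_filter => i; rewrite -antidiagonal_in_skew0.
rewrite filter_interval // addKn -[h in iota h]addn0 iotaDl -map_comp -[RHS](mkseq_nth 0).
by apply: eq_map => i /=; rewrite addKn.
Qed.

Lemma antidiagonal_columnS c cs q :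
  column (antidiagonal (c :: cs)) q.+1 = column (antidiagonal cs) q.
Proof.
rewrite /column /= size_cat size_map size_nseq iotaD filter_cat.
rewrite (eq_filter (fun i => antidiagonal_in_skewS c cs i q)).
rewrite (eq_filter (a1 := fun i => in_skew (antidiagonal (c :: cs)) i q.+1)
                   (fun i => antidiagonal_in_skewS c cs i q)).
rewrite [X in _ ++ X](_ : _ = [::]) ?cats0 //.
apply/eqP; rewrite -[_ == _]negbK -has_filter; apply/hasPn => i; rewrite mem_iota => /andP[hi _].
by rewrite /in_skew /in_diagram nth_default.
Qed.

Lemma antidiagonal_columns (cs : seq (seq nat)) : [::] \notin cs -> columns (antidiagonal cs) = cs.
Proof.
move=> ne; have hd : head 0 (outer (antidiagonal cs)) = size cs.
  elim: cs ne => //= c cs IH; rewrite inE negb_or => /andP[c0 /IH].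
  case: (outer _) => [|m s] /= h; last by rewrite h.
  by move: c0 h; case: c => //= x c _ <-.
have E : [seq column (antidiagonal cs) j | j <- iota 0 (size cs)] = cs.
  elim: cs {ne hd} => // c cs IH.
  rewrite /= antidiagonal_column0 -[1]addn0 iotaDl -map_comp; congr cons.
  by rewrite -[RHS]IH; apply: eq_map => q; rewrite /= antidiagonal_columnS.
rewrite /columns hd E.
by apply/all_filterP/allP => c cc; apply: contraNneq ne => <-.
Qed.

(** Every list of columns with the contents of a tableau [T] up to Knuth
    equivalence, and of the right lengths, comes from a frank skew tableau: by
    uniqueness the antidiagonal skew tableau has no other rectification. *)
Lemma frank_with_exists n lam T cs : semistandard n lam T -> all is_col cs ->
  [::] \notin cs -> knuth (flatten cs) (flatten (dcols (straight T))) ->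
  perm_eq (shape cs) (shape (dcols (straight T))) ->
  exists S, [/\ skew_tableau n S, frank_with S T & columns S = map rev cs].
Proof.
move=> sT hcs ne kn pe; have [tT z] := straight_tableau sT.
have ne' : [::] \notin map rev cs.
  by apply: contra ne => /mapP[c cc E]; rewrite -[[::]]/(rev [::]) E revK.
have tS : skew_tableau n (antidiagonal (map rev cs)).
  apply: antidiagonal_tableau => c /mapP[d dcs ->].
  have /andP[sd _] := allP hcs d dcs; rewrite rev_sorted; split=> // x.
  rewrite mem_rev => xd.
  have : x \in flatten (dcols (straight T)).
    by rewrite -(perm_mem (knuth_perm kn)); apply/flattenP; exists d.
  case/flattenP=> e /mapP[f]; rewrite mem_filter => /andP[_ /mapP[q _ ->]] ->.
  by rewrite mem_rev; have [_] := skew_tableau_col q tT; apply.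
have cS : columns (antidiagonal (map rev cs)) = map rev cs by apply: antidiagonal_columns.
have dS : dcols (antidiagonal (map rev cs)) = cs.
  by rewrite /dcols cS -map_comp (eq_map (@revK _)) map_id.
exists (antidiagonal (map rev cs)); split=> //; split; last first.
  by rewrite cS shape_map_rev -(shape_map_rev (columns (straight T))).
have [S' [r tS' z']] := rectification_exists tS.
have [_ kn'] := slides_knuth r tS.
have E : dcols S' = dcols (straight T).
  apply: straight_unique; rewrite ?nil_dcols ?(skew_tableau_dcols tS') ?(skew_tableau_dcols tT) //.
  - exact: straight_no_inner tS' z'.
  - exact: straight_no_inner tT z.
  - by apply: knuth_trans kn; apply: knuth_sym; rewrite -{1}dS.
have Ec : columns S' = columns (straight T).
  by apply: (inj_map (can_inj (@revK nat))); exact: E.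
have [[_ so1] _ _ _ _] := tS'; have [[_ so2] _ _ _ _] := tT.
have Eh : head 0 (outer S') = head 0 (shape T).
  have := congr1 size Ec; rewrite (columns_no_inner tS' z') (columns_no_inner tT z).
  by rewrite !size_map !size_iota.
have Eq q : q < head 0 (shape T) -> column S' q = column (straight T) q.
  move=> hq; have := congr1 (nth [::] ^~ q) Ec.
  rewrite (columns_no_inner tS' z') (columns_no_inner tT z) !(nth_map 0) ?size_iota ?Eh //.
  by rewrite nth_iota.
have Ein p q : in_diagram (outer S') p q = in_diagram (shape T) p q.
  case: (ltnP q (head 0 (shape T))) => hq.
    rewrite !in_diagram_col // -(size_column_no_inner tS' z') Eq //.
    by rewrite (size_column_no_inner tT z).
  have F nu : sorted geq nu -> head 0 nu <= q -> in_diagram nu p q = false.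
    by move=> so h; apply/negP => /(in_diagram_bound so)[_]; rewrite ltnNge h.
  by rewrite !F // Eh.
exists S'; split=> //.
- by move=> i j; rewrite /inside_corner /in_diagram z'.
- by move=> i j; rewrite (in_skew_no_inner z') Ein.
- move=> i j; rewrite (in_skew_no_inner z') => D; have [_ hj] := in_diagram_bound so1 D.
  have := congr1 (nth 0 ^~ i) (Eq j _); rewrite -Eh => /(_ hj).
  rewrite (column_no_inner tS' z') (column_no_inner tT z).
  have D1 := D; rewrite in_diagram_col // in D1.
  have D2 := D; rewrite Ein in_diagram_col // in D2.
  by rewrite !(nth_map 0) ?size_iota ?nth_iota.
Qed.

(** * Right keys of tableaux of staircase shape *)

Lemma nth_staircase n i : nth 0 (staircase n) i = n - i.
Proof.
case: (ltnP i n) => h; last by rewrite nth_default ?size_rev ?size_iota //; lia.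
by rewrite nth_rev size_iota // nth_iota; lia.
Qed.

Lemma size_staircase n : size (staircase n) = n.
Proof. by rewrite size_rev size_iota. Qed.

Lemma sorted_staircase n : sorted geq (staircase n).
Proof. by apply: nth_partition => i; rewrite !nth_staircase; lia. Qed.

Lemma head_staircase n : head 0 (staircase n) = n.
Proof. by rewrite -nth0 nth_staircase subn0. Qed.

Lemma col_length_staircase n j : col_length (staircase n) j = n - j.
Proof.
have so := sorted_staircase n.
apply/eqP; rewrite eqn_leq; apply/andP; split.
  by rewrite leqNgt -in_diagram_col // /in_diagram nth_staircase; lia.
case: (posnP (n - j)) => [->//|h].
by rewrite -(prednK h) -in_diagram_col // /in_diagram nth_staircase; lia.
Qed.

Definition tcol (T : seq (seq nat)) (q : nat) : seq nat := rev (column (straight T) q).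

Section Staircase.
Variables (n : nat) (T : seq (seq nat)).
Hypothesis sT : semistandard n (staircase n) T.

Let tT := (straight_tableau sT).1.
Let z := (straight_tableau sT).2.

Lemma size_tcol q : size (tcol T q) = n - q.
Proof. by rewrite size_rev (size_column_no_inner tT z) /= sT.1 col_length_staircase. Qed.

Lemma tcol_is_col q : is_col (tcol T q).
Proof.
have [so bd] := skew_tableau_col q tT.
rewrite /is_col rev_sorted so all_rev; apply/allP => x /bd /andP[] //.
Qed.

Lemma tcol_bound q x : x \in tcol T q -> 1 <= x <= n.
Proof. by rewrite mem_rev; have [_] := skew_tableau_col q tT; apply. Qed.

Lemma dcols_staircase : dcols (straight T) = [seq tcol T q | q <- iota 0 n].
Proof. by rewrite /dcols (columns_no_inner tT z) -map_comp /= sT.1 head_staircase. Qed.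

Lemma tcols_straight : straight_cols [seq tcol T q | q <- iota 0 n].
Proof. by rewrite -dcols_staircase; apply: straight_no_inner tT z. Qed.

Lemma tcols_is_col : all is_col [seq tcol T q | q <- iota 0 n].
Proof. by apply/allP => c /mapP[q _ ->]; apply: tcol_is_col. Qed.

Lemma nil_tcols : [::] \notin [seq tcol T q | q <- iota 0 n].
Proof. by rewrite -dcols_staircase nil_dcols. Qed.

(** The exchanges which sort a frank skew tableau into [T] bring its last column
    to its place in [T], to the left of the next shorter column. *)
Lemma right_key_lower R j k s : is_right_key n (staircase n) T R -> j < n -> k <= s ->
  count_ge s (tcol T j) + count_in k s (tcol T j.+1) <= count_ge k (column (straight R) j).
Proof.
move=> [_ H] jn ks; have [|S [tS fr sz ->]] := H j; first by rewrite head_staircase.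
have [kn pe] := frank_with_knuth sT tS fr.
have hS := skew_tableau_dcols tS.
rewrite dcols_staircase in kn pe.
have fS : frank (dcols S).
  apply: frank_transfer (straight_frank tcols_is_col tcols_straight) _ _ => //.
  - exact: tcols_is_col.
  - exact: knuth_sym.
  - by rewrite perm_sym.
rewrite /rightmost_column col_length_staircase in sz *.
have [u [c Ec]] : exists u c, columns S = rcons u c.
  by case: (lastP (columns S)) sz => [/= sz|u c _]; [lia | exists u, c].
rewrite Ec last_rcons in sz *.
have Ed : dcols S = rcons (map rev u) (rev c) by rewrite /dcols Ec map_rcons.
rewrite Ed in hS fS kn pe.
have [l [a [r [hl so pl kl [sa bd]]]]] := frank_last_col hS fS.
have frl : frank (l ++ a :: r) by apply: frank_transfer fS kl pl.
have nel : [::] \notin l ++ a :: r.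
  by rewrite -nil_shape -(perm_mem pl) (perm_mem pe) nil_shape nil_tcols.
have El : l ++ a :: r = [seq tcol T q | q <- iota 0 n].
  apply: straight_unique => //.
  - exact: tcols_is_col.
  - exact: frank_sorted_straight.
  - exact: tcols_straight.
  - exact: nil_tcols.
  - by apply: knuth_trans kn; apply: knuth_sym.
have sl : size l < n.
  by have := congr1 size El; rewrite size_cat size_map size_iota /=; lia.
have nthE q : nth [::] (l ++ a :: r) q = tcol T q.
  rewrite El; case: (ltnP q n) => qn; first by rewrite (nth_map 0) ?size_iota // nth_iota.
  rewrite nth_default ?size_map ?size_iota //.
  by apply/esym/eqP; rewrite -size_eq0 size_tcol subn_eq0.
have Ej : size l = j.
  have := nthE (size l); rewrite nth_cat ltnn subnn /= => Ea.
  by move: sa; rewrite Ea size_tcol size_rev sz; lia.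
have Ea : a = tcol T j by rewrite -nthE nth_cat Ej ltnn subnn.
have Er : head [::] r = tcol T j.+1.
  by rewrite -nthE nth_cat Ej ltnNge leqnSn /= subSnn /= nth0.
have := bd k s ks; rewrite Ea Er /count_ge count_rev.
by [].
Qed.

Definition tab_of_cols (c : nat -> seq nat) : seq (seq nat) :=
  mkseq (fun i => mkseq (fun q => nth 0 (c q) i) (n - i)) n.

Lemma shape_tab_of_cols c : shape (tab_of_cols c) = staircase n.
Proof.
apply: (@eq_from_nth _ 0); rewrite size_map size_mkseq ?size_staircase // => i ni.
by rewrite (nth_map [::]) ?size_mkseq // nth_mkseq // size_mkseq nth_staircase.
Qed.

Lemma tab_of_cols_entry c i j : j < n - i -> tab_entry (tab_of_cols c) i j = nth 0 (c j) i.
Proof. by move=> h; rewrite /tab_entry nth_mkseq ?nth_mkseq //; lia. Qed.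

Lemma tab_of_cols_column c j : j < n -> size (c j) = n - j ->
  column (straight (tab_of_cols c)) j = c j.
Proof.
move=> jn sc; rewrite /column /= shape_tab_of_cols size_staircase.
have -> : [seq i <- iota 0 n | in_skew (straight (tab_of_cols c)) i j] = iota 0 (n - j).
  rewrite -[RHS](_ : [seq i <- iota 0 n | 0 <= i < n - j] = _); last first.
    by rewrite filter_interval ?subn0 // leq_subr.
  apply: eq_filter => i; rewrite /in_skew /in_diagram /= nth_nil shape_tab_of_cols nth_staircase.
  by lia.
rewrite -[RHS](mkseq_nth 0) sc; apply/eq_in_map => i; rewrite mem_iota => hi /=.
by rewrite tab_of_cols_entry //; lia.
Qed.

(** The [j]th column moves to the right end.  The hypothesis on a single exchange
    is asked for all columns [a] within the bound, as the column changes on its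
    way. *)
Lemma right_key_upper (G : nat -> nat -> nat) :
  (forall j k, j < n -> count_ge k (tcol T j) <= G j k) ->
  (forall j j' a, j < j' < n -> is_col a -> size a = n - j -> dominates a (tcol T j') ->
     (forall k, count_ge k a <= G j k) ->
     forall k s, k <= s -> count_ge s a + count_in k s (tcol T j') <= G j k) ->
  exists2 R, is_right_key n (staircase n) T R &
    forall j k, j < n -> count_ge k (column (straight R) j) <= G j k.
Proof.
move=> HG Hstep.
have H j : exists c, j < n -> [/\ size c = n - j, forall k, count_ge k c <= G j k &
    exists S, [/\ skew_tableau n S, frank_with S T & rightmost_column S = c]].
  case: (ltnP j n) => jn; last by exists [::].
  have Ei : iota 0 n = iota 0 j ++ j :: iota j.+1 (n - j.+1).
    by have := @iota_split 0 n j; rewrite !subn0; apply.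
  pose r := [seq tcol T q | q <- iota j.+1 (n - j.+1)].
  have Ecs : [seq tcol T q | q <- iota 0 n] = [seq tcol T q | q <- iota 0 j] ++ tcol T j :: r.
    by rewrite Ei map_cat.
  have fr : frank (tcol T j :: r).
    by have := straight_frank tcols_is_col tcols_straight; rewrite Ecs => /frank_cat[].
  have hc : all is_col (tcol T j :: r).
    by have := tcols_is_col; rewrite Ecs all_cat => /andP[].
  have st : straight_cols (tcol T j :: r).
    by have := tcols_straight; rewrite Ecs => /straight_catr.
  have [||r' [a' [h1 h2 h3 h4]]] := move_right (g := G j) hc fr (straight_sorted st).
  - by move=> k; apply: HG.
  - move=> b a /mapP[q]; rewrite mem_iota => hq ->; rewrite size_tcol.
    by move=> ha sa da ga k s ks; apply: Hstep => //; lia.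
  pose cs := [seq tcol T q | q <- iota 0 j] ++ rcons r' a'.
  have pe : perm_eq (shape cs) (shape (dcols (straight T))).
    rewrite dcols_staircase Ecs !shape_cat perm_cat2l h2; apply/permPl/perm_rcons.
  have [||||S [tS fS cS]] := frank_with_exists (cs := cs) sT.
  - rewrite all_cat h1 andbT; apply/allP => c /mapP[q _ ->]; exact: tcol_is_col.
  - by rewrite -nil_shape (perm_mem pe) nil_shape nil_dcols.
  - rewrite dcols_staircase Ecs !flatten_cat; apply: knuth_catl; exact: knuth_sym.
  - exact: pe.
  exists (rev a') => _; split.
  - have := congr1 (last 0) h2; rewrite shape_rcons !last_rcons size_rev => ->.
    by rewrite size_tcol.
  - by move=> k; rewrite /count_ge count_rev; apply: h4.
  - by exists S; split=> //; rewrite /rightmost_column cS map_cat map_rcons last_cat last_rcons.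
have [c hc] := choice H.
exists (tab_of_cols c).
  split=> [|j]; first exact: shape_tab_of_cols.
  rewrite head_staircase => jn; have [sc _ [S [tS fS rS]]] := hc j jn.
  by exists S; rewrite rS sc col_length_staircase tab_of_cols_column.
move=> j k jn; have [sc gc _] := hc j jn.
by rewrite tab_of_cols_column.
Qed.

End Staircase.

Lemma nth_lt_count (c : seq nat) s i : sorted leq c -> i < size c ->
  (nth 0 c i < s) = (i < count_lt s c).
Proof.
elim: c i => //= x c IH i so ic; have so' : sorted leq c := path_sorted so.
have min y : y \in c -> x <= y by have /allP := order_path_min leq_trans so; apply.
have z : s <= x -> count_lt s c = 0.
  move=> sx; apply/eqP; rewrite -leqn0 leqNgt -has_count; apply/hasPn => y /min xy.
  by rewrite -leqNgt (leq_trans sx).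
case: i ic => [_|i ic] /=; first by case: (ltnP x s) => // /z ->.
rewrite IH //; case: (ltnP x s) => [_|/z ->]; first by rewrite add1n ltnS.
by rewrite ltn0.
Qed.

Lemma nth_le_dominates (c d : seq nat) : sorted leq c -> sorted leq d -> size d <= size c ->
  (forall i, i < size d -> nth 0 c i <= nth 0 d i) <-> dominates c d.
Proof.
move=> sc sd szd; split=> H.
  move=> s; case E: (count_lt s d) => [//|i].
  have di : i < size d.
    by apply: leq_trans (count_size (fun x => x < s) d); rewrite -/(count_lt s d) E.
  rewrite -nth_lt_count //; last exact: leq_trans szd.
  by apply: leq_ltn_trans (H i di) _; rewrite nth_lt_count // E.
move=> i di; rewrite -ltnS nth_lt_count //; last exact: leq_trans szd.
by apply: leq_trans (H _); rewrite -nth_lt_count.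
Qed.

Lemma dominates_count_ge c d : size c = size d ->
  dominates d c <-> forall k, count_ge k d <= count_ge k c.
Proof.
move=> E; split=> H k; have := H k.
  by have := count_ge_lt k c; have := count_ge_lt k d; lia.
by have := count_ge_lt k c; have := count_ge_lt k d; lia.
Qed.

Section Demazure.
Variables (n : nat) (w : 'S_n).

Lemma size_one_row : size (one_row w) = n.
Proof. by rewrite size_map size_enum_ord. Qed.

Lemma key_entry i j : i < n -> j < n - i ->
  tab_entry (key (staircase n) w) i j = nth 0 (sort leq (take (n - j) (one_row w))) i.
Proof.
move=> hi hj; rewrite /tab_entry /key size_staircase (nth_map 0) ?size_iota // nth_iota //.
by rewrite (nth_map 0) ?size_iota nth_staircase // nth_iota // col_length_staircase.
Qed.

Lemma right_key_sorted T R j : is_right_key n (staircase n) T R -> j < n ->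
  sorted ltn (column (straight R) j).
Proof.
move=> [_ H] jn; have [|S [tS _ _ ->]] := H j; first by rewrite head_staircase.
rewrite /rightmost_column; have := allP (skew_tableau_dcols tS).
rewrite /dcols; case: (lastP (columns S)) => //= u c {}H; rewrite last_rcons.
have /andP[] : is_col (rev c) by apply/H/map_f; rewrite mem_rcons mem_head.
by rewrite rev_sorted.
Qed.

Lemma tab_le_key R : shape R = staircase n ->
  (forall j, j < n -> sorted ltn (column (straight R) j)) ->
  tab_le R (key (staircase n) w) <->
  (forall j k, j < n ->
     count_ge k (column (straight R) j) <= count_ge k (take (n - j) (one_row w))).
Proof.
move=> sR soR.
have col j : j < n -> [/\ sorted ltn (column (straight R) j),
    column (straight R) j = [seq tab_entry R i j | i <- iota 0 (n - j)] &
    size (column (straight R) j) = n - j].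
  move=> jn; have Ec : column (straight R) j = [seq tab_entry R i j | i <- iota 0 (n - j)].
    rewrite /column /= sR size_staircase.
    rewrite -[iota 0 (n - j)](_ : [seq i <- iota 0 n | 0 <= i < n - j] = _); last first.
      by rewrite filter_interval ?subn0 // leq_subr.
    congr map; apply: eq_filter => i; rewrite /in_skew /in_diagram /= nth_nil sR nth_staircase.
    by lia.
  by split; [exact: soR | | rewrite Ec size_map size_iota].
pose Y j := take (n - j) (one_row w).
have E j : j < n -> (forall k, count_ge k (column (straight R) j) <= count_ge k (Y j)) <->
    (forall i, i < n - j -> tab_entry R i j <= tab_entry (key (staircase n) w) i j).
  move=> jn; have [so Ec sz] := col j jn.
  have so' : sorted leq (column (straight R) j).
    by apply: sub_sorted so => x y; apply: ltnW.
  have szk : size (column (straight R) j) = size (sort leq (Y j)).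
    by rewrite sz size_sort size_takel // size_one_row leq_subr.
  have := nth_le_dominates so' (sort_sorted leq_total (Y j)) (eq_leq (esym szk)).
  have -> : dominates (column (straight R) j) (sort leq (Y j)) <->
    forall k, count_ge k (column (straight R) j) <= count_ge k (sort leq (Y j)).
    exact: dominates_count_ge.
  rewrite -szk sz => -[H1 H2]; split=> H.
    move=> i hi; have := H2 _ i hi.
    rewrite Ec (nth_map 0) ?size_iota // nth_iota // key_entry; try lia.
    by apply=> k; have := H k; rewrite {2}/count_ge -(count_sort leq) -Ec.
  move=> k; have -> : count_ge k (Y j) = count_ge k (sort leq (Y j)).
    by rewrite /count_ge count_sort.
  apply: H1 => i hi; rewrite Ec (nth_map 0) ?size_iota // nth_iota //.
  by have := H i hi; rewrite key_entry //; lia.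
split=> H.
  move=> j k jn; move: k; apply/(E j jn) => i hi; apply: H.
  by rewrite sR /in_diagram nth_staircase; lia.
move=> i j; rewrite sR /in_diagram nth_staircase => hij; have jn : j < n by lia.
by have := (E j jn).1 (fun k => H j k jn) i; apply; lia.
Qed.

Lemma demazure_lower T j k s : demazure (staircase n) w T -> j < n -> k <= s ->
  count_ge s (tcol T j) + count_in k s (tcol T j.+1) <= count_ge k (take (n - j) (one_row w)).
Proof.
move=> [sT [R [rk /(tab_le_key rk.1 (fun j => right_key_sorted rk)) le]]] jn ks.
exact: leq_trans (right_key_lower sT rk jn ks) (le j k jn).
Qed.

Lemma demazure_upper T (G : nat -> nat -> nat) : semistandard n (staircase n) T ->
  (forall j k, j < n -> count_ge k (tcol T j) <= G j k) ->
  (forall j j' a, j < j' < n -> is_col a -> size a = n - j -> dominates a (tcol T j') ->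
     (forall k, count_ge k a <= G j k) ->
     forall k s, k <= s -> count_ge s a + count_in k s (tcol T j') <= G j k) ->
  (forall j k, j < n -> G j k <= count_ge k (take (n - j) (one_row w))) ->
  demazure (staircase n) w T.
Proof.
move=> sT H1 H2 H3; split=> //; have [R rk le] := right_key_upper sT H1 H2.
exists R; split=> //; apply/(tab_le_key rk.1 (fun j => right_key_sorted rk)) => j k jn.
exact: leq_trans (le j k jn) (H3 j k jn).
Qed.

End Demazure.

(** * Demazure sets of 312-avoiding permutations *)

Lemma nth_one_row n (w : 'S_n) (i : 'I_n) : nth 0 (one_row w) i = (w i).+1.
Proof. by rewrite (nth_map i) ?size_enum_ord // nth_ord_enum. Qed.

Lemma one_row_uniq n (w : 'S_n) : uniq (one_row w).
Proof.
by rewrite map_inj_uniq ?enum_uniq // => i j [/val_inj/perm_inj].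
Qed.

Lemma mem_one_row n (w : 'S_n) x : (x \in one_row w) = (0 < x <= n).
Proof.
apply/mapP/idP => [[i _ ->]|]; first by rewrite /= ltn_ord.
case: x => //= x xn; exists ((w^-1)%g (Ordinal xn)); first by rewrite mem_enum.
by rewrite permKV.
Qed.

Lemma mem_take_nth (s : seq nat) k x :
  x \in take k s -> exists2 i, i < minn k (size s) & nth 0 s i = x.
Proof.
case/(nthP 0) => i; rewrite size_take_min => hi E; exists i => //.
by rewrite -E nth_take //; move: hi; rewrite leq_min => /andP[].
Qed.

Lemma take_uniq_sub (s : seq nat) k l x : k <= l -> x \in take k s -> x \in take l s.
Proof. by move=> kl; rewrite -(take_takel s kl) => /mem_take. Qed.

Lemma count_sub_uniq (P : pred nat) c d : uniq c ->
  (forall x, x \in c -> P x -> x \in d) -> count P c <= count P d.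
Proof.
move=> uc sub; rewrite -!size_filter; apply: uniq_leq_size; first exact: filter_uniq.
by move=> x; rewrite !mem_filter => /andP[Px xc]; rewrite Px sub.
Qed.

(** Unless the claim is clear, the interval [k, s) contains more letters of [B]
    than of the first [l] values of [w].  Then the first [m] values cannot all be
    below [s], as they bound [B].  Moreover, one of these letters of [B] is a
    value of [w] after the first [l] ones, so that 312-avoidance forbids values
    below [k] between the positions [m] and [l]. *)
Lemma avoids_312_step n (w : 'S_n) l m A B k s : avoids_312 w ->
  m < l <= n -> size A = l -> size B = m -> is_col B ->
  (forall x, x \in B -> 1 <= x <= n) -> dominates A B ->
  (forall i, count_ge i A <= count_ge i (take l (one_row w))) ->
  (forall i, count_ge i B <= count_ge i (take m (one_row w))) ->
  k <= s -> count_ge s A + count_in k s B <= count_ge k (take l (one_row w)).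
Proof.
move=> av ml sA sB cB bB AB HA HB ks.
set X := one_row w in HA HB *.
have sX : size X = n by rewrite size_one_row.
case: (leqP (count_in k s B) (count_in k s (take l X))) => [le|lt].
  by rewrite (count_ge_in _ ks) leq_add.
have [v vB /andP[/andP[kv vs] vX]] : exists2 v, v \in B & (k <= v < s) && (v \notin take l X).
  apply/hasP; apply: contraLR lt => /hasPn H; rewrite -leqNgt.
  apply: count_sub_uniq (is_col_uniq cB) _ => x xB kxs.
  by have := H x xB; rewrite kxs /= negbK.
have [c lc Ec] : exists2 c : 'I_n, l <= c & (w c).+1 = v.
  have /mapP[c _ Ec] : v \in X by rewrite mem_one_row; apply: bB.
  exists c => //; rewrite leqNgt; apply: contra vX => cl.
  rewrite Ec -nth_one_row -(nth_take 0 cl); apply: mem_nth.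
  by rewrite size_takel // sX; case/andP: ml.
case: (boolP (has (leq s) (take m X))) => [/hasP[u um su]|/hasPn small].
  have [a am Ea] := mem_take_nth um; rewrite sX in am.
  have low : count_lt k (take l X) <= count_lt k (take m X).
    apply: count_sub_uniq => [|x /mem_take_nth[b bl Eb] xk].
      exact: take_uniq (one_row_uniq w).
    rewrite sX in bl; case: (ltnP b m) => bm.
      by rewrite -Eb -(nth_take 0 bm); apply: mem_nth; rewrite size_takel // sX; lia.
    have an : a < n by lia. have bn : b < n by lia.
    case: av; exists (Ordinal an), (Ordinal bn), c; split=> /=; try lia.
      have := nth_one_row w (Ordinal bn); rewrite /= -/X Eb; lia.
    have := nth_one_row w (Ordinal an); rewrite /= -/X Ea; lia.
  have E1 := count_ge_lt s A; have E2 := count_ge_lt k (take l X).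
  have E3 := count_ge_lt k B; have E4 := count_ge_lt k (take m X).
  have E5 := count_ge_lt s B; have E6 := count_ge_in B ks.
  have sl : size (take l X) = l by rewrite size_takel // sX; lia.
  have sm : size (take m X) = m by rewrite size_takel // sX; lia.
  have := AB s; have := HB k; rewrite sA sB sl sm in E1 E2 E3 E4 E5 *.
  lia.
have : count_in k s B <= count_in k s (take l X); last by lia.
apply: (@leq_trans (count_ge k B)); first by rewrite (count_ge_in _ ks) leq_addl.
apply: leq_trans (HB k) _.
have -> : count_ge k (take m X) = count_in k s (take m X).
  by apply: eq_in_count => x /small; rewrite -ltnNge => ->; rewrite andbT.
apply: count_sub_uniq => [|x xm _]; first exact: take_uniq (one_row_uniq w).
by apply: take_uniq_sub xm; lia.
Qed.

Section Avoid.
Variables (n : nat) (w : 'S_n).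
Hypothesis av : avoids_312 w.

(** A tableau is always below its right key.  Conversely the bound by the key of
    [w] persists while a column moves to the right end. *)
Lemma avoids_312_demazure T : demazure (staircase n) w T <->
  semistandard n (staircase n) T /\ tab_le T (key (staircase n) w).
Proof.
have E (sT : semistandard n (staircase n) T) : tab_le T (key (staircase n) w) <->
  (forall j k, j < n -> count_ge k (tcol T j) <= count_ge k (take (n - j) (one_row w))).
  have H := @tab_le_key _ w T sT.1 (fun j _ => (skew_tableau_col j (straight_tableau sT).1).1).
  split=> [/H le j k jn|le]; first by rewrite /count_ge /tcol count_rev; apply: le.
  by apply/H => j k jn; have := le j k jn; rewrite {1}/count_ge /tcol count_rev.
split=> [d|[sT /(E sT) le]].
  have [sT _] := d; split=> //; apply/(E sT) => j k jn.
  by have := demazure_lower d jn (leqnn k); apply: leq_trans; apply: leq_addr.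
apply: (demazure_upper sT le) => // j j' a jj ca sa aT ga k s ks.
have [j1 j2] := andP jj.
apply: (@avoids_312_step _ w (n - j) (n - j')) => //.
- lia.
- by rewrite (size_tcol sT).
- exact: tcol_is_col sT _.
- by move=> x; apply: tcol_bound sT _ _.
- by move=> i; apply: le.
Qed.

End Avoid.

(** * Tableaux with prescribed columns *)

Lemma count_lt_map (g h : nat -> nat) s (c : seq nat) : (forall x, x \in c -> h x <= g x) ->
  count_lt s (map g c) <= count_lt s (map h c).
Proof.
move=> H; rewrite /count_lt !count_map; elim: c H => //= x c IH H; apply: leq_add.
  by have := H x (mem_head _ _); case: ltnP => // gs hg; rewrite (leq_ltn_trans hg gs).
by apply: IH => y yc; apply: H; rewrite inE yc orbT.
Qed.

Lemma count_ge_map (g h : nat -> nat) k (c : seq nat) : (forall x, x \in c -> g x <= h x) ->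
  count_ge k (map g c) <= count_ge k (map h c).
Proof.
move=> H; have := count_ge_lt k (map g c); have := count_ge_lt k (map h c).
by rewrite !size_map; have := count_lt_map k H; lia.
Qed.

Lemma tab_of_cols_semistandard n (c : nat -> seq nat) :
  (forall j, j < n ->
     [/\ sorted ltn (c j), size (c j) = n - j & forall x, x \in c j -> 1 <= x <= n]) ->
  (forall j, j.+1 < n -> dominates (c j) (c j.+1)) ->
  semistandard n (staircase n) (tab_of_cols n c).
Proof.
move=> H D; split; first exact: shape_tab_of_cols.
have Ein i j : in_skew (straight (tab_of_cols n c)) i j = (i + j < n).
  by rewrite /in_skew /in_diagram /= nth_nil shape_tab_of_cols nth_staircase; lia.
split=> /=; rewrite ?shape_tab_of_cols ?sorted_staircase //.
- by move=> i; rewrite nth_nil.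
- move=> i j; rewrite Ein => ij; rewrite tab_of_cols_entry; last by lia.
  have [|_ sz] := H j; first by lia.
  by apply; apply: mem_nth; rewrite sz; lia.
- move=> i j; rewrite !Ein => _ ij; rewrite !tab_of_cols_entry; try lia.
  have [|s1 z1 _] := H j; first by lia.
  have [|s2 z2 _] := H j.+1; first by lia.
  have sub d : sorted ltn d -> sorted leq d by apply: sub_sorted => x y; apply: ltnW.
  have le : size (c j.+1) <= size (c j) by rewrite z1 z2; lia.
  apply: (nth_le_dominates (sub _ s1) (sub _ s2) le).2; first by apply: D; lia.
  by rewrite z2; lia.
- move=> i j; rewrite !Ein => _ ij; rewrite !tab_of_cols_entry; try lia.
  have [|s1 z1 _] := H j; first by lia.
  by apply: (sorted_ltn_nth ltn_trans) => //; rewrite ?inE z1; lia.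
Qed.

(** Nested columns, as those of a key, do not change when they are moved to the
    right. *)
Lemma nested_demazure n (w : 'S_n) T : semistandard n (staircase n) T ->
  (forall j j', j < j' < n -> {subset tcol T j' <= tcol T j}) ->
  (forall j k, j < n -> count_ge k (tcol T j) <= count_ge k (take (n - j) (one_row w))) ->
  demazure (staircase n) w T.
Proof.
move=> sT nest le.
apply: (demazure_upper (G := fun j k => count_ge k (tcol T j)) sT _ _ le) => //.
move=> j j' a jj _ _ _ ga k s ks; rewrite (count_ge_in _ ks) leq_add //.
apply: count_sub_uniq (is_col_uniq (tcol_is_col sT j')) _ => x xj _.
exact: nest xj.
Qed.

(** * Three collinear tableaux *)

(** Among the first [b + 1] values of [w], in one row form, [p] and [q] are
    the neighbours of [r], which is the value of [w] at a later position.
    Exchanging [p] with the value [xb] at the position [b] makes [w] smaller, and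
    the columns [base] of its key, of length at most [b], avoid the numbers from
    [p] to [q.-1].  So [q] can be replaced by any [t] from [p] to [q] without
    changing the order of the entries.  For [t = p] and [t = q] this gives keys
    again. *)
Section Collinear.
Variables (n : nat) (w : 'S_n) (b p q r : nat).
Let X := one_row w.
Let xb := nth 0 X b.
Hypotheses (bn : b < n) (pA : p \in take b.+1 X) (qA : q \in take b.+1 X).
Hypotheses (rX : r \in X) (rA : r \notin take b.+1 X) (pr : p < r) (rq : r < q).
Hypothesis xbp : xb <= p.
Hypothesis neighbours : forall x, x \in take b.+1 X -> (x <= p) || (q <= x).

Definition base (k : nat) : seq nat :=
  sort leq (map (fun x => if x == p then xb else x) (take k X)).

Definition replaced (t k : nat) : seq nat :=
  if k <= b then map (fun x => if x == q then t else x) (base k) else sort leq (take k X).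

Lemma take_bS : take b.+1 X = rcons (take b X) xb.
Proof. by rewrite -take_nth // size_one_row. Qed.

Lemma xb_notin k : k <= b -> xb \notin take k X.
Proof.
move=> kb; apply/negP => h; have /(take_uniq_sub kb) := h.
by have := take_uniq b.+1 (one_row_uniq w); rewrite -/X take_bS rcons_uniq => /andP[/negP].
Qed.

Lemma base_lt k x : k <= b -> x \in base k -> (x \in take b.+1 X) && ((x < p) || (q <= x)).
Proof.
move=> kb; rewrite mem_sort => /mapP[v vk ->].
have vb : v \in take b.+1 X by apply: take_uniq_sub vk; apply: leqW.
case: eqP => [vp|/eqP vp].
  rewrite take_bS mem_rcons mem_head /=; case: (ltngtP xb p) xbp => //= xbp' _.
  by have := xb_notin kb; rewrite xbp' -vp vk.
by rewrite vb /=; have := neighbours vb; rewrite leq_eqVlt (negPf vp).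
Qed.

Lemma base_sorted k : k <= b -> sorted ltn (base k).
Proof.
move=> kb; rewrite ltn_sorted_uniq_leq sort_sorted ?andbT; last exact: leq_total.
rewrite sort_uniq map_inj_in_uniq; first exact: take_uniq (one_row_uniq w).
move=> x y xk yk; have := xb_notin kb.
by case: eqP => [->|_]; case: eqP => [->|_] // H E; move: H; rewrite ?E ?yk // -E xk.
Qed.

Lemma replaced_sorted t k : p <= t <= q -> sorted ltn (replaced t k).
Proof.
move=> /andP[pt tq]; rewrite /replaced; case: leqP => kb; last first.
  rewrite ltn_sorted_uniq_leq sort_sorted ?andbT; last exact: leq_total.
  by rewrite sort_uniq; apply: take_uniq (one_row_uniq w).
apply: (homo_sorted_in (P := mem (base k)) (e := ltn)); last exact: base_sorted.
  move=> x y /(base_lt kb) /andP[_ hx] /(base_lt kb) /andP[_ hy] xy.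
  by case: eqP => [xq|_]; case: eqP => [yq|_]; lia.
by apply/allP.
Qed.

Lemma size_replaced t k : k <= n -> size (replaced t k) = k.
Proof.
move=> kn; rewrite /replaced; case: ifP => _;
  by rewrite ?size_map size_sort ?size_map size_takel // size_one_row.
Qed.

Lemma replaced_sub t k x : k <= b -> x \in replaced t k -> (x \in take b.+1 X) || (x == t).
Proof.
move=> kb; rewrite /replaced kb => /mapP[v /(base_lt kb) /andP[vb _] ->].
by case: eqP => _; rewrite ?eqxx ?orbT ?vb.
Qed.

Lemma replaced_large t k : b < k -> replaced t k = sort leq (take k X).
Proof. by move=> bk; rewrite /replaced leqNgt bk. Qed.

Lemma replaced_bound t k x : t \in X -> x \in replaced t k -> 1 <= x <= n.
Proof.
move=> tX; rewrite -(mem_one_row w) -/X; case: (leqP k b) => kb.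
  by case/(replaced_sub kb)/orP => [/mem_take|/eqP ->].
by rewrite replaced_large // mem_sort => /mem_take.
Qed.

Lemma replaced_subset t k l : k <= l <= b -> {subset replaced t k <= replaced t l}.
Proof.
move=> /andP[kl lb] x; rewrite /replaced lb (leq_trans kl lb).
case/mapP=> v; rewrite mem_sort => /mapP[u uk ->] ->; apply: map_f; rewrite mem_sort.
by apply: map_f; apply: take_uniq_sub uk.
Qed.

Lemma replaced_nested t k l : t \in take b.+1 X -> k <= l -> {subset replaced t k <= replaced t l}.
Proof.
move=> tA kl; case: (leqP l b) => lb; first by apply: replaced_subset; rewrite kl.
move=> x; rewrite (replaced_large t lb) mem_sort; case: (leqP k b) => kb.
  move/(replaced_sub kb) => h; apply: (@take_uniq_sub _ b.+1) => //.
  by case/orP: h => // /eqP ->.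
by rewrite replaced_large // mem_sort; apply: take_uniq_sub.
Qed.

Lemma replaced_dominates t k l : p <= t <= q -> k <= l -> dominates (replaced t l) (replaced t k).
Proof.
move=> ptq kl s; have u t' k' : p <= t' <= q -> uniq (replaced t' k').
  move=> h; apply: sorted_uniq (replaced_sorted _ h); [exact: ltn_trans | exact: ltnn].
case: (leqP l b) => lb.
  apply: count_sub_uniq (u _ _ ptq) _ => x xk _.
  by apply: replaced_subset xk; rewrite kl.
case: (leqP k b) => kb; last first.
  rewrite !replaced_large // /count_lt !count_sort.
  by apply: count_sub_uniq (take_uniq _ (one_row_uniq w)) _ => x xk _; apply: take_uniq_sub xk.
apply: (@leq_trans (count_lt s (replaced p k))).
  rewrite /replaced kb; apply: count_lt_map => x _; case: eqP => // _.
  by case/andP: ptq.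
have -> : replaced t l = replaced p l by rewrite !replaced_large.
apply: count_sub_uniq (u _ _ _) _ => [|x xk _]; first by rewrite leqnn; lia.
exact: replaced_nested xk.
Qed.

Lemma replaced_le t k i : t <= q -> count_ge i (replaced t k) <= count_ge i (take k X).
Proof.
move=> tq; rewrite /replaced; case: ifP => _; last by rewrite /count_ge count_sort.
apply: (@leq_trans (count_ge i (base k))).
  by rewrite -{2}[base k]map_id; apply: count_ge_map => x _; case: eqP => // ->.
rewrite /count_ge /base count_sort -/(count_ge _ _) -{2}[take k X]map_id.
by apply: count_ge_map => x _; case: eqP => // ->.
Qed.

Definition tab (t : nat) : seq (seq nat) := tab_of_cols n (fun j => replaced t (n - j)).

Lemma tab_semistandard t : p <= t <= q -> t \in X -> semistandard n (staircase n) (tab t).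
Proof.
move=> ptq tX; apply: tab_of_cols_semistandard => j jn.
  split; [exact: replaced_sorted | by rewrite size_replaced ?leq_subr |].
  by move=> x; apply: replaced_bound.
by apply: replaced_dominates => //; lia.
Qed.

Lemma tcol_tab t j : j < n -> tcol (tab t) j = rev (replaced t (n - j)).
Proof. by move=> jn; rewrite /tcol tab_of_cols_column // size_replaced // leq_subr. Qed.

Lemma tab_demazure t : p <= t <= q -> t \in take b.+1 X -> demazure (staircase n) w (tab t).
Proof.
move=> ptq tA; apply: nested_demazure.
- by apply: tab_semistandard => //; apply: mem_take tA.
- move=> j j' /andP[jj jn] x; rewrite !tcol_tab ?(ltn_trans jj jn) // !mem_rev.
  by apply: replaced_nested => //; lia.
- move=> j k jn; rewrite tcol_tab // /count_ge count_rev.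
  by apply: replaced_le; case/andP: ptq.
Qed.

(** The column of length [b + 1] of a right key has more entries above [p] than
    the first [b + 1] values of [w]: to the entries from [q] on, the exchange
    with the next column adds [r]. *)
Lemma tab_not_demazure : ~ demazure (staircase n) w (tab r).
Proof.
move=> D; have pq := ltn_trans pr rq.
have qb : q \in take b X.
  by move: qA; rewrite take_bS mem_rcons inE => /orP[/eqP qx|//]; move: xbp; rewrite -qx; lia.
have b0 : 0 < b by move: qb; case: (b) => //; rewrite take0.
have jn : n - b.+1 < n by lia.
have := demazure_lower D jn pq; rewrite tcol_tab // tcol_tab; last by lia.
rewrite (_ : n - (n - b.+1) = b.+1); last by lia.
rewrite (_ : n - (n - b.+1).+1 = b); last by lia.
have z : count_in p.+1 q (take b.+1 X) = 0.
  apply/eqP; rewrite -leqn0 leqNgt -has_count; apply/hasPn => x /neighbours; lia.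
rewrite (count_ge_in (take b.+1 X) pq) z addn0 replaced_large //.
rewrite /count_ge /count_in !count_rev count_sort -[Y in _ <= Y]addn0 leq_add2l leqn0.
move/eqP => {}z.
suff : 0 < count (fun x => p < x < q) (replaced r b) by rewrite z.
rewrite -has_count; apply/hasP; exists r; last by rewrite pr.
rewrite /replaced leqnn; apply/mapP; exists q; last by rewrite eqxx.
rewrite mem_sort; apply/mapP; exists q => //.
by case: eqP => // qp; move: pq; rewrite qp ltnn.
Qed.

Lemma tab_collinear i j : i + j < n ->
  (q - p) * tab_entry (tab r) i j =
  (q - r) * tab_entry (tab p) i j + (r - p) * tab_entry (tab q) i j.
Proof.
move=> ij; rewrite !tab_of_cols_entry; try lia.
rewrite /replaced; case: ifP => kb; last by rewrite -mulnDl; congr muln; lia.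
have h : i < size (base (n - j)).
  by rewrite size_sort size_map size_takel ?size_one_row; lia.
rewrite !(nth_map 0) //; case: eqP => _; last by rewrite -mulnDl; congr muln; lia.
by rewrite -(subnKC (ltnW rq)) -(subnKC (ltnW pr)); nia.
Qed.
End Collinear.

(** * Integral points of polyhedra *)

Section Polytope.
Import GRing.Theory Num.Theory Order.TTheory.
Local Open Scope ring_scope.

Lemma polytope_of_system (R : realType) N (I : finType) (a : I -> 'rV[int]_N) (b : I -> int) :
  convex_polytope R [set x : 'cV[int]_N | forall c, (a c *m x) 0 0 <= b c]%classic.
Proof.
(* [None] stands for the inequality 0 <= 0, which ensures that there is a row. *)
pose a' (o : option I) : 'rV[int]_N := if o is Some c then a c else 0.
pose b' (o : option I) : int := if o is Some c then b c else 0.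
exists #|{: option I}|, (\matrix_(r, k) (a' (enum_val r) 0 k)%:~R), (\col_r (b' (enum_val r))%:~R).
split; first by apply/card_gt0P; exists None.
have E r (x : 'cV[int]_N) :
    ((\matrix_(r < #|{: option I}|, k < N) (a' (enum_val r) 0 k)%:~R : 'M[R]_(_, _)) *m
      map_mx intr x) r ord0 = ((a' (enum_val r) *m x) 0 0)%:~R.
  by rewrite !mxE rmorph_sum; apply: eq_bigr => k _; rewrite !mxE rmorphM.
apply/seteqP; split=> x /= H.
  move=> r; rewrite E [X in _ <= X]mxE ler_int; case: (enum_val r) => [c|]; first exact: H.
  by rewrite /a' /b' mul0mx mxE.
by move=> c; have := H (enum_rank (Some c)); rewrite E [X in _ <= X]mxE ler_int enum_rankK.
Qed.

Lemma polytope_convex (R : realType) N (S : set 'cV[int]_N) (x y z : 'cV[int]_N) (s t : nat) :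
  convex_polytope R S -> S x -> S y -> (0 < s + t)%N ->
  (forall k, (s + t)%N%:Z * z k 0 = s%:Z * x k 0 + t%:Z * y k 0) -> S z.
Proof.
move=> [m [A [b [_ ->]]]] /= Hx Hy st0 E i.
have lin : (s + t)%N%:R * (A *m map_mx intr z) i 0 =
    s%:R * (A *m map_mx intr x) i 0 + t%:R * (A *m map_mx intr y) i 0.
  rewrite !mxE !mulr_sumr -big_split /=; apply: eq_bigr => k _; rewrite !mxE.
  have Ek : (s + t)%N%:R * (z k 0)%:~R = s%:R * (x k 0)%:~R + t%:R * (y k 0)%:~R :> R.
    have := congr1 (intr : int -> R) (E k).
    by rewrite [X in X = _ -> _]rmorphM [X in _ = X -> _]rmorphD !rmorphM.
  by rewrite mulrCA Ek mulrDr ![A i k * (_ * _)]mulrCA.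
have st : (0 : R) < (s + t)%N%:R by rewrite ltr0n.
rewrite -(ler_pM2l st) lin natrD mulrDl.
by apply: lerD; apply: ler_wpM2l => //; rewrite ler0n.
Qed.

End Polytope.

(** * Boxes of the staircase *)

Section Boxes.
Variable n : nat.
Let N := sumn (staircase n).
Definition box (i j : nat) : nat := flatten_index (staircase n) i j.

Lemma box_lt i j : i + j < n -> box i j < N.
Proof.
move=> h; by apply: flatten_indexP; rewrite nth_staircase; lia.
Qed.

Lemma boxP k : k < N -> exists i j, i + j < n /\ k = box i j.
Proof.
move=> kN; exists (reshape_index (staircase n) k), (reshape_offset (staircase n) k).
split; last by rewrite /box reshape_indexK.
have := reshape_offsetP kN; have := reshape_indexP kN.
by rewrite nth_staircase size_staircase; lia.
Qed.

Lemma nth_box T i j : shape T = staircase n -> i + j < n ->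
  nth 0 (flatten T) (box i j) = tab_entry T i j.
Proof.
move=> sT h; have kN := box_lt h; rewrite nth_flatten sT /box.
rewrite flatten_indexKl ?flatten_indexKr //; rewrite ?nth_staircase; lia.
Qed.
End Boxes.

(** * The polytope of a principal ideal *)

Section Ideal.
Import GRing.Theory Num.Theory Order.TTheory.
Local Open Scope ring_scope.
Variable n : nat.
Let N := sumn (staircase n).

Definition coordinate_form (k : nat) : 'rV[int]_N := \row_(l < N) ((l : nat) == k)%:R.

Definition coordinate (x : 'cV[int]_N) (k : nat) : int := (coordinate_form k *m x) 0 0.

Lemma coordinateE x k (kN : (k < N)%N) : coordinate x k = x (Ordinal kN) 0.
Proof.
rewrite /coordinate mxE (bigD1 (Ordinal kN)) //= mxE eqxx mul1r big1 ?addr0 // => l lk.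
rewrite mxE (_ : ((l : nat) == k) = false) ?mul0r //.
by apply: contraNF lk => /eqP E; apply/eqP/val_inj.
Qed.

Lemma coordinate_tab_point T i j : shape T = staircase n -> (i + j < n)%N ->
  coordinate (tab_point (staircase n) T) (box n i j) = (tab_entry T i j)%:Z.
Proof.
by move=> sT ij; rewrite (coordinateE _ (box_lt ij)) mxE /= nth_box.
Qed.

Lemma tab_pointP x T : shape T = staircase n ->
  (forall i j, (i + j < n)%N -> coordinate x (box n i j) = (tab_entry T i j)%:Z) ->
  tab_point (staircase n) T = x.
Proof.
move=> sT H; apply/colP => k; have [i [j [ij Ek]]] := boxP (ltn_ord k).
have -> : k = Ordinal (box_lt ij) by apply/val_inj.
by rewrite -!coordinateE coordinate_tab_point // H.
Qed.

Section System.
Variable K : nat -> nat -> nat.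

(** The four inequalities at a box: positivity, the bound, and the conditions
    for the right and the lower neighbours. *)
Definition ideal_form (c : 'I_4 * ('I_n * 'I_n)) : 'rV[int]_N :=
  let: (t, (i, j)) := c in
  match val t with
  | 0%N => if (i + j < n)%N then - coordinate_form (box n i j) else 0
  | 1%N => if (i + j < n)%N then coordinate_form (box n i j) else 0
  | 2%N => if (i + j.+1 < n)%N then
      coordinate_form (box n i j) - coordinate_form (box n i j.+1) else 0
  | _ => if (i.+1 + j < n)%N then
      coordinate_form (box n i j) - coordinate_form (box n i.+1 j) else 0
  end.

Definition ideal_bound (c : 'I_4 * ('I_n * 'I_n)) : int :=
  let: (t, (i, j)) := c in
  match val t with
  | 0%N => if (i + j < n)%N then -1 else 0
  | 1%N => if (i + j < n)%N then (K i j)%:Z else 0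
  | 2%N => 0
  | _ => if (i.+1 + j < n)%N then -1 else 0
  end.

Lemma form0 (x : 'cV[int]_N) : ((0 : 'rV[int]_N) *m x) 0 0 = 0.
Proof. by rewrite mul0mx mxE. Qed.

Lemma formN x k : ((- coordinate_form k) *m x) 0 0 = - coordinate x k.
Proof. by rewrite mulNmx [LHS]mxE. Qed.

Lemma formB x k l :
  ((coordinate_form k - coordinate_form l) *m x) 0 0 = coordinate x k - coordinate x l.
Proof. by rewrite mulmxBl [LHS]mxE [X in _ + X]mxE. Qed.

Lemma ideal_systemP x : (forall c, (ideal_form c *m x) 0 0 <= ideal_bound c) <->
  [/\ forall i j, (i + j < n)%N -> 1 <= coordinate x (box n i j) <= (K i j)%:Z,
      forall i j, (i + j.+1 < n)%N -> coordinate x (box n i j) <= coordinate x (box n i j.+1) &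
      forall i j, (i.+1 + j < n)%N -> coordinate x (box n i j) + 1 <= coordinate x (box n i.+1 j)].
Proof.
split=> [H|[H1 H2 H3] [[[|[|[|[|//]]]] t4] [i j]]] /=.
- have I4 (t : nat) (t4 : (t < 4)%N) i j (hi : (i < n)%N) (hj : (j < n)%N) :=
    H (Ordinal t4, (Ordinal hi, Ordinal hj)).
  split=> i j ij; have hi : (i < n)%N by lia.
  + have hj : (j < n)%N by lia.
    have := I4 0%N isT i j hi hj; have := I4 1%N isT i j hi hj.
    by rewrite /= ij formN -/(coordinate _ _) => -> h; rewrite andbT; lia.
  + have hj : (j < n)%N by lia.
    by have := I4 2%N isT i j hi hj; rewrite /= ij formB; lia.
  + have hj : (j < n)%N by lia.
    by have := I4 3%N isT i j hi hj; rewrite /= ij formB; lia.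
- by case: ifP => ij; rewrite ?form0 // formN; have := H1 i j ij; lia.
- by case: ifP => ij; rewrite ?form0 // -/(coordinate _ _); case/andP: (H1 i j ij).
- by case: ifP => ij; rewrite ?form0 // formB; have := H2 i j ij; lia.
- by case: ifP => ij; rewrite ?form0 // formB; have := H3 i j ij; lia.
Qed.

Lemma ideal_polytope (R : realType) : (forall i j, (i + j < n)%N -> (K i j <= n)%N) ->
  convex_polytope R (image [set T | semistandard n (staircase n) T /\
    forall i j, (i + j < n)%N -> (tab_entry T i j <= K i j)%N]%classic (tab_point (staircase n))).
Proof.
move=> Kn; rewrite [X in convex_polytope R X](_ : _ =
  [set x : 'cV[int]_N | forall c, (ideal_form c *m x) 0 0 <= ideal_bound c]%classic);
  first exact: polytope_of_system.
apply/seteqP; split=> [x [T [[sT tT] TK] <-]|x /ideal_systemP[H1 H2 H3]].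
  have Ein i j : in_skew (straight T) i j = (i + j < n)%N.
    by rewrite /in_skew /in_diagram /= nth_nil sT nth_staircase; lia.
  have [_ _ bd row col] := tT.
  apply/ideal_systemP; split=> i j ij; rewrite !coordinate_tab_point //; try lia.
  - have := bd i j; rewrite Ein ij => /(_ isT) /andP[h _]; have := TK i j ij.
    by rewrite /= in h; lia.
  - by have := row i j; rewrite !Ein ij (_ : (i + j < n)%N) => [/(_ isT isT) /=|]; lia.
  - by have := col i j; rewrite !Ein ij (_ : (i + j < n)%N) => [/(_ isT isT) /=|]; lia.
pose T := mkseq (fun i => mkseq (fun j => `|coordinate x (box n i j)|%N) (n - i)) n.
have ET i j : (i + j < n)%N -> (tab_entry T i j)%:Z = coordinate x (box n i j).
  move=> ij; rewrite /tab_entry nth_mkseq; last by lia.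
  rewrite nth_mkseq; last by lia.
  by have := H1 i j ij; lia.
have sT : shape T = staircase n.
  apply: (@eq_from_nth _ 0%N); rewrite size_map size_mkseq ?size_staircase // => i ni.
  by rewrite (nth_map [::]) ?size_mkseq // nth_mkseq // size_mkseq nth_staircase.
exists T; last by apply: tab_pointP => // i j ij; rewrite ET.
have Ein i j : in_skew (straight T) i j = (i + j < n)%N.
  by rewrite /in_skew /in_diagram /= nth_nil sT nth_staircase; lia.
split; last by move=> i j ij; have := H1 i j ij; rewrite -ET //; lia.
split=> //; split=> [|i|i j|i j|i j]; rewrite ?Ein.
- by rewrite /= sT sorted_staircase.
- by rewrite nth_nil.
- by move=> ij /=; have := H1 i j ij; have := Kn i j ij; rewrite -ET //; lia.
- by move=> ij ij'; have := H2 i j ij'; rewrite -!ET.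
- by move=> ij ij'; have := H3 i j ij'; rewrite -!ET //= ; lia.
Qed.

End System.
End Ideal.

(** * Convexity and 312-avoidance *)

Lemma neighbours_exist (A : seq nat) r u v : r \notin A -> u \in A -> u < r -> v \in A -> r < v ->
  exists p q, [/\ p \in A, q \in A, p < r, r < q & u <= p /\
    forall x, x \in A -> (x <= p) || (q <= x)].
Proof.
move=> rA uA ur vA rv.
have exP : exists x, (x \in A) && (x < r) by exists u; rewrite uA.
have exQ : exists x, (x \in A) && (r < x) by exists v; rewrite vA.
have bP x : (x \in A) && (x < r) -> x <= r by case/andP=> _ /ltnW.
case: (ex_maxnP exP bP) => p /andP[pA pr] pmax; case: (ex_minnP exQ) => q /andP[qA rq] qmin.
exists p, q; split=> //; split=> [|x xA]; first by apply: pmax; rewrite uA.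
case: (ltngtP x r) => xr; [by rewrite pmax ?xA | by rewrite qmin ?xA ?orbT |].
by rewrite -xr xA in rA.
Qed.

Theorem theorem3p9p1 (R : realType) (n : nat) (hn : 1 <= n) (w : 'S_n) :
  convex_polytope R
    (image (demazure (staircase n) w) (tab_point (staircase n)))
  <-> avoids_312 w.
Proof.
split=> [poly [a [b [c [ab bc wbc wca]]]]|av]; last first.
  have key_le i j : i + j < n -> tab_entry (key (staircase n) w) i j <= n.
    move=> ij; rewrite key_entry; try lia.
    set k := n - j; set s := sort _ _.
    have sz : size s = k by rewrite size_sort size_takel // size_one_row leq_subr.
    have : nth 0 s i \in s by apply: mem_nth; rewrite sz /k; lia.
    by rewrite mem_sort => /mem_take; rewrite mem_one_row => /andP[].
  suff -> : demazure (staircase n) w = [set T | semistandard n (staircase n) T /\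
      forall i j, i + j < n -> tab_entry T i j <= tab_entry (key (staircase n) w) i j]%classic.
    exact: ideal_polytope.
  apply/seteqP; split=> T /=.
    case/(avoids_312_demazure av) => sT le; split=> // i j ij; apply: le.
    by rewrite sT.1 /in_diagram nth_staircase; lia.
  case=> sT le; apply/(avoids_312_demazure av); split=> // i j.
  by rewrite sT.1 /in_diagram nth_staircase => ij; apply: le; lia.
pose X := one_row w; pose A := take b.+1 X; pose r := nth 0 X c.
have memA (i : 'I_n) : i <= b -> nth 0 X i \in A.
  move=> ib; rewrite -(nth_take 0 (n0 := b.+1)) ?ltnS //; apply: mem_nth.
  by rewrite size_takel // size_one_row.
have rX : r \in X by apply: mem_nth; rewrite size_one_row.
have rA : r \notin A.
  apply/negP => /mem_take_nth[i]; rewrite size_one_row => ib /eqP.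
  rewrite nth_uniq ?size_one_row ?one_row_uniq //; last by lia.
  by move/eqP; lia.
have [||p [q [pA qA pr rq [xbp nb]]]] :=
  neighbours_exist rA (memA b (leqnn b)) _ (memA a (ltnW ab)).
- by rewrite /r !nth_one_row.
- by rewrite /r !nth_one_row.
have pq := ltn_trans pr rq; have bn := ltn_ord b.
have col := tab_collinear bn pA qA rX rA pr rq xbp.
have Dp : demazure (staircase n) w (tab w b p q p).
  apply: (tab_demazure bn pA qA rX rA pr rq xbp nb) pA.
  by rewrite leqnn ltnW.
have Dq : demazure (staircase n) w (tab w b p q q).
  apply: (tab_demazure bn pA qA rX rA pr rq xbp nb) qA.
  by rewrite leqnn ltnW.
apply: (tab_not_demazure bn pA qA rX rA pr rq xbp nb).
have sh t : shape (tab w b p q t) = staircase n := shape_tab_of_cols _ _.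
have [||||T DT ET] := polytope_convex (x := tab_point _ (tab w b p q p))
  (y := tab_point _ (tab w b p q q)) (z := tab_point (staircase n) (tab w b p q r))
  (s := q - r) (t := r - p) poly.
- by exists (tab w b p q p).
- by exists (tab w b p q q).
- by lia.
- move=> k; have [i [j [ij Ek]]] := boxP (ltn_ord k).
  rewrite !mxE Ek !nth_box // -!PoszM -PoszD -col //.
  by rewrite (_ : q - r + (r - p) = q - p) //; lia.
suff <- : T = tab w b p q r by [].
have sT : shape T = staircase n by case: DT => -[].
apply: (@eq_from_nth _ [::]).
  by rewrite -!(size_map size) -!/(shape _) sT sh.
move=> i iT; apply: (@eq_from_nth _ 0).
  by rewrite -!nth_shape sT sh.
move=> j; rewrite -nth_shape sT nth_staircase => ij.
have ij' : i + j < n by lia.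
have := congr1 (fun x => coordinate x (box n i j)) ET.
by rewrite !coordinate_tab_point // => -[].
Qed.
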